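(* Let $G$ be a directed graph obtained from the graph with the single vertex $1$ and no edges by the ear-adding construction described in the context, and let $k$ be any vertex of $G$. Then the linear compartmental model $(G,\{1\},\{1\},\{k\})$ (input and output in compartment $1$, a single leak in compartment $k$) is locally identifiable.
   Context: Construction. Begin with $V=\{1\}$, $E=\emptyset$. First step: add new vertices $n_1,\ldots,n_s$ ($s\ge 1$) and edges $1\to n_1$, $n_i\to n_{i+1}$ for $i=1,\ldots,s-1$, and $n_s\to 1$. Subsequent steps (repeated any number of times): choose vertices $p,q$ of the current graph (possibly equal), add new vertices $m_1,\ldots,m_t$ ($t\ge 1$) and edges $p\to m_1$, $m_i\to m_{i+1}$ for $i=1,\ldots,t-1$, and $m_t\to q$. (During the construction every vertex has a leak; at the end all leaks except one, at a vertex $k$, are removed, giving the model $(G,\{1\},\{1\},\{k\})$.) A linear compartmental model $(G,In,Out,Leak)$ consists of a finite directed graph $G=(V,E)$ and subsets $In,Out,Leak\subseteq V$. Each edge $j\to i$ carries an independent parameter $a_{ij}$ and each $i\in Leak$ an independent parameter $a_{0i}$. The compartmental matrix $A$ has $A_{ij}=a_{ij}$ if $j\to i\in E$; $A_{ii}=-a_{0i}-\sum_{k:\,i\to k\in E}a_{ki}$ if $i\in Leak$; $A_{ii}=-\sum_{k:\,i\to k\in E}a_{ki}$ if $i\notin Leak$; all other entries $0$. The model is $x'=Ax+u$, $y_i=x_i$ for $i\in Out$, with $u_i\equiv 0$ for $i\notin In$. For $In=Out=\{1\}$ and $G$ strongly connected the input-output equation is $\det(\partial I-A)\,y_1=\det(\partial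 I-A)_{11}\,u_1$, where $\partial=d/dt$ and $(\cdot)_{11}$ means delete row $1$ and column $1$. The coefficient map $c:\mathbb{R}^{|E|+|Leak|}\to\mathbb{R}^m$ collects all nonzero, nonmonic coefficients (polynomials in the parameters) of this equation. The model is (generically) locally identifiable if, outside a set of measure zero in parameter space, every point has a neighborhood on which $c$ is one-to-one; equivalently, the Jacobian of $c$ has rank $|E|+|Leak|$ at a generic point. *)

(* Defs.v *)
From HB Require Import structures.
From mathcomp Require Import all_boot all_order all_algebra.
From mathcomp Require Import all_classical all_reals all_analysis.

Set Implicit Arguments.
Unset Strict Implicit.
Unset Printing Implicit Defensive.

Import Order.TTheory GRing.Theory Num.Theory.
Import numFieldNormedType.Exports.

Local Open Scope classical_set_scope.
Local Open Scope ring_scope.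

(* Compartments are the elements of 'I_n.+1 and compartment 1 is ord0.  A pair
   (j, i) stands for the directed edge j -> i.  ear_edges p s q is the set of
   edges of the walk p -> m_1 -> ... -> m_t -> q, where s = [:: m_1; ...; m_t]. *)
Definition ear_edges (n : nat) (p : 'I_n.+1) (s : seq 'I_n.+1) (q : 'I_n.+1) :
    {set 'I_n.+1 * 'I_n.+1} :=
  [set:: zip (p :: s) (rcons s q)].

(* ear_graph W E: the graph with vertex set W and edge set E is produced by the
   construction.  No order is imposed on the labels of the new vertices, so that
   every labelling of the constructed graph is covered. *)
Inductive ear_graph (n : nat) :
    {set 'I_n.+1} -> {set 'I_n.+1 * 'I_n.+1} -> Prop :=
| EarFirst (s : seq 'I_n.+1) :
    (0 < size s)%N -> uniq s -> ord0 \notin s ->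
    ear_graph (ord0 |: [set:: s]) (ear_edges ord0 s ord0)
| EarNext (W : {set 'I_n.+1}) (E : {set 'I_n.+1 * 'I_n.+1})
    (p q : 'I_n.+1) (s : seq 'I_n.+1) :
    ear_graph W E -> p \in W -> q \in W ->
    (0 < size s)%N -> uniq s -> {in s, forall v, v \notin W} ->
    ear_graph (W :|: [set:: s]) (E :|: ear_edges p s q).

Record model (n : nat) := Model {
  edges : {set 'I_n.+1 * 'I_n.+1};
  inputs : {set 'I_n.+1};
  outputs : {set 'I_n.+1};
  leaks : {set 'I_n.+1}
}.

Definition param (n : nat) (M : model n) : finType :=
  ({e : 'I_n.+1 * 'I_n.+1 | e \in edges M} + {i : 'I_n.+1 | i \in leaks M})%type.

Lemma card_param (n : nat) (M : model n) :
  #|param M| = (#|edges M| + #|leaks M|)%N.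
Proof. by rewrite card_sum !card_sig. Qed.

(* The parameter a_{ij} of the edge j -> i; 0 if this is not an edge *)
Definition edge_rate (R : realType) (n : nat) (M : model n)
    (th : 'rV[R]_(#|param M|)) (i j : 'I_n.+1) : R :=
  if insub (j, i) is Some e then th 0 (enum_rank (inl e : param M)) else 0.

(* The parameter a_{0i}; 0 if i is not a leak *)
Definition leak_rate (R : realType) (n : nat) (M : model n)
    (th : 'rV[R]_(#|param M|)) (i : 'I_n.+1) : R :=
  if insub i is Some l then th 0 (enum_rank (inr l : param M)) else 0.

(* The parameter of a loop i -> i would only occur in the diagonal sum; the graphs
   of interest are loop-free. *)
Definition compartmental_mx (R : realType) (n : nat) (M : model n)
    (th : 'rV[R]_(#|param M|)) : 'M[R]_n.+1 :=
  \matrix_(i, j)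
    if i == j
    then - leak_rate th i - \sum_(k | (i, k) \in edges M) edge_rate th k i
    else edge_rate th i j.

(* The input-output equations of a model with strongly connected graph: for each
   output i, Cramer's rule applied to (d/dt I - A) x = u gives
     det(d/dt I - A) y_i = sum_(j in In) adj(d/dt I - A)_{ij} u_j,
   with 'X in the role of d/dt.  For In = Out = {1} this is
   det(d/dt I - A) y_1 = det((d/dt I - A)_{11}) u_1. *)
Definition io_polys (R : realType) (n : nat) (M : model n) :
    seq ('rV[R]_(#|param M|) -> {poly R}) :=
  flatten [seq
      (fun th => char_poly (compartmental_mx th))
        :: [seq (fun th => \adj (char_poly_mx (compartmental_mx th)) i j)
            | j <- enum (inputs M)]
    | i <- enum (outputs M)].

Lemma io_polys_siso (R : realType) (n : nat) (M : model n) :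
  inputs M = [set ord0]%SET -> outputs M = [set ord0]%SET ->
  io_polys R M =
    [:: (fun th => \det (char_poly_mx (compartmental_mx th)));
        (fun th => \det (row' ord0 (col' ord0
                     (char_poly_mx (compartmental_mx th)))))].
Proof.
move=> hI hO; rewrite /io_polys hI hO !enum_set1 /=; congr [:: _; _].
by apply/funext => th; rewrite mxE /cofactor addn0 expr0 mul1r.
Qed.

(* The degrees in 'X are at most n.+1.  A coefficient that vanishes as a function
   vanishes as a polynomial, R being infinite; and as the coefficients are
   homogeneous in the parameters, only leading ones can be identically 1. *)
Definition io_coefs (R : realType) (n : nat) (M : model n) :
    seq ('rV[R]_(#|param M|) -> R) :=
  [seq c <- [seq (fun th => (p th : {poly R})`_d) | p <- io_polys R M, d <- iota 0 n.+2]
     | `[< c <> cst 0 /\ c <> cst 1 >]].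

Definition coef_map (R : realType) (n : nat) (M : model n)
    (th : 'rV[R]_(#|param M|)) : 'rV[R]_(size (io_coefs R M)) :=
  \row_i nth (cst 0) (io_coefs R M) i th.

(* Lebesgue null subsets of R^m: outer measure zero, by coverings with boxes *)
Definition lebesgue_null (R : realType) (m : nat) (N : set 'rV[R]_m) : Prop :=
  forall e : R, 0 < e ->
  exists a b : nat -> 'rV[R]_m,
    [/\ forall k i, a k 0 i <= b k 0 i,
        N `<=` \bigcup_k [set x : 'rV[R]_m | forall i, a k 0 i <= x 0 i <= b k 0 i]
      & (\sum_(0 <= k <oo) (\prod_i (b k 0 i - a k 0 i))%:E <= e%:E)%E].

Definition locally_identifiable (R : realType) (n : nat) (M : model n) : Prop :=
  exists2 N : set 'rV[R]_(#|param M|), lebesgue_null N &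
    forall th, ~ N th -> exists2 U, nbhs th U & set_inj U (@coef_map R n M).

(* Main.v *)
Require Import Defs.
From HB Require Import structures.
From mathcomp Require Import all_boot all_order all_algebra.
From mathcomp Require Import all_classical all_reals all_analysis.
From mathcomp Require Import ring lra.
From mathcomp Require mpoly.
Import -(notations) mpoly.

(** The proof rests on one exact identity. Write A(th) for the compartmental
    matrix and adj for the adjugate. If th and th' give the same input-output
    equation then, for every real x,
      (adj (x - A(th)) * (A(th) - A(th')) * adj (x - A(th')))_11 = 0
    ([adj_sub_adj00]). As A is linear in the parameters, this is a linear system
    for th - th', whose matrix [jacobian th th'] depends polynomially on th and
    th'. Suppose that it has full row rank at one point (th0, th0), and let Q be
    a right inverse there. Then det (jacobian th th *m Q) is a nonzero polynomial
    in th, and wherever it does not vanish, det (jacobian th' th'' *m Q) is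
    nonzero for th', th'' near th by continuity, so that the coefficient map is
    injective near th ([locally_identifiable_row_free]). The zero set of a
    nonzero polynomial is null ([lebesgue_null_zeros]): by induction on the
    degree it reduces to the zeros at which some partial derivative does not
    vanish, and these lie, locally, on a Lipschitz graph over a coordinate
    hyperplane.

    It remains to find th0. With G(x) = (x - A)^-1, the functional attached to
    the entry (i, j) of the matrix is, up to the factor det (x - A)^2, the
    function G_1i(x) G_j1(x) ([edge_response]). Allow all diagonal entries for a
    moment, that is, a leak at every vertex. Induction on the ears yields a
    matrix A carried by the graph, with positive entries on the edges, for which
    |E| + 1 of the functions G_1i G_j1 (edges j -> i and diagonal entries) are
    linearly independent ([ear_certificate], [ear_graph_certificate]). Indeed,
    let an ear from p to q have weight 1 on its edges except for a weight w on
    the last one, and diagonal entries b_m. Eliminating its vertices replaces it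
    by a single edge p -> q of weight w / beta(x), with beta(x) the product of
    the x - b_m ([ear_resolvent_loop], [ear_resolvent_last]). As w tends to 0 the
    old functions tend to those of the old graph, and the new ones, after
    division by w for the diagonal entries, tend to g / (beta * (x - b_m)) and
    g / beta, where g = G_1q G_p1. If the b_m are distinct and large then g does
    not vanish at b_m, and comparing poles shows that the limits are independent
    ([indep_ear0]). Independence is an open condition ([indep_on_near]), so it
    holds for some small w > 0.

    Finally, commutators of A with diagonal matrices are invisible to the
    functionals ([adj_commutator_adj00]). Let y0 be large, so that (y0 - A)^-1
    has positive entries, and let r be its row k. Then
    diag(r) (A - y0) diag(r)^-1 has zero column sums except in column k, hence is
    the compartmental matrix of a model with a single leak at k; moreover each
    elementary matrix is the sum of such a matrix and of a commutator. So the
    jacobian at this point has rank at least |E| + 1, the number of parameters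
    ([full_rank_jacobian]). *)

Set Implicit Arguments.
Unset Strict Implicit.
Unset Printing Implicit Defensive.

Import Order.TTheory GRing.Theory Num.Theory.
Import numFieldNormedType.Exports.

Local Open Scope classical_set_scope.
Local Open Scope ring_scope.

(** * Linearly independent families of functions *)

(** Linear independence of the functions [F i], [i \in T], restricted to the
    points satisfying [D]. *)
Definition indep_on (R : fieldType) (I : finType) (X : Type) (D : X -> Prop)
    (T : {set I}) (F : I -> X -> R) : Prop :=
  forall c : I -> R, (forall x, D x -> \sum_(i in T) c i * F i x = 0) ->
  forall i, i \in T -> c i = 0.

(** Independence is always detected by finitely many points: add the indices one
    at a time, with one further point whenever the points found so far leave a
    relation, which is then unique up to scaling. *)
Lemma indep_on_finite (R : fieldType) (I : finType) (X : eqType) (D : X -> Prop)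
    (T : {set I}) (F : I -> X -> R) :
  indep_on D T F ->
  exists2 s : seq X, forall x, x \in s -> D x & indep_on (fun x => x \in s) T F.
Proof.
elim: {T}#|T| {-2}T (erefl #|T|) => [|k IH] T cT indT.
  exists [::] => // c _ i; move/eqP: cT; rewrite cards_eq0 => /eqP ->.
  by rewrite inE.
have /set0Pn[i0 i0T] : T != finset.set0 by rewrite -cards_eq0 cT.
have splitT c x : \sum_(i in T) c i * F i x =
    c i0 * F i0 x + \sum_(i in T :\ i0) c i * F i x.
  by rewrite (big_setD1 i0).
have [||s sD indS] := IH (T :\ i0).
- by have := cardsD1 i0 T; rewrite i0T cT add1n => -[].
- move=> c cF i iT; pose c' j := if j == i0 then 0 else c j.
  have -> : c i = c' i by move: iT; rewrite /c' !inE; case: eqP.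
  apply: indT => [x Dx|]; last by case/setD1P: iT.
  rewrite splitT /c' eqxx mul0r add0r -[RHS](cF x Dx).
  by apply: eq_bigr => j /setD1P[/negbTE -> _].
have [indT'|] := pselect (indep_on (fun x => x \in s) T F); first by exists s.
move=> /existsNP[c /not_implyP[cF /existsNP[i /not_implyP[iT /eqP ci]]]].
have c0 : c i0 != 0.
  apply: contra ci => /eqP c0; have [->|ii0] := eqVneq i i0; first exact/eqP.
  apply/eqP/indS => [x xs|]; last by rewrite !inE ii0.
  by have := cF x xs; rewrite splitT c0 mul0r add0r.
have [x /not_implyP[Dx /eqP cx]] :
    exists x, ~ (D x -> \sum_(i in T) c i * F i x = 0).
  by apply/existsNP => /indT /(_ i iT)/eqP; apply/negP.
exists (x :: s) => [y|c' c'F j jT].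
  by rewrite inE => /predU1P[->|/sD].
pose a := c' i0 / c i0.
have E l : l \in T -> c' l = a * c l.
  move=> lT; have [->|li0] := eqVneq l i0; first by rewrite /a divfK.
  apply/eqP; rewrite -subr_eq0; apply/eqP.
  apply: (indS (fun l => c' l - a * c l)); last by rewrite !inE li0.
  move=> y ys.
  have := c'F y; rewrite inE ys orbT splitT => /(_ isT) h1.
  have := cF y ys; rewrite splitT => h2.
  have -> : \sum_(i in T :\ i0) (c' i - a * c i) * F i y =
     \sum_(i in T :\ i0) c' i * F i y - a * \sum_(i in T :\ i0) c i * F i y.
    rewrite mulr_sumr -sumrB; apply: eq_bigr => m _.
    by rewrite mulrBl mulrA.
  move/eqP: h1; rewrite addrC addr_eq0 => /eqP ->.
  move/eqP: h2; rewrite addrC addr_eq0 => /eqP ->.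
  by rewrite mulrN opprK mulrA divfK // addNr.
have := c'F x (mem_head _ _).
rewrite (eq_bigr (fun i => a * (c i * F i x))); last first.
  by move=> m mT; rewrite E // mulrA.
rewrite -mulr_sumr => /eqP; rewrite mulf_eq0 (negbTE cx) orbF => /eqP a0.
by rewrite E // a0 mul0r.
Qed.

(** Values of the functions [F i], one row for each [i \in T] and one column for
    each point of [s]. *)
Definition sample_mx (R : fieldType) (I : finType) (X : Type) (T : {set I})
    (F : I -> X -> R) (s : seq X) : 'M[R]_(#|T|, size s) :=
  \matrix_(r, l) F (enum_val r) (tnth (in_tuple s) l).

Lemma row_free_sample_mx (R : fieldType) (I : finType) (X : eqType) (T : {set I})
    (F : I -> X -> R) (s : seq X) :
  indep_on (fun x => x \in s) T F <-> row_free (sample_mx T F s).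
Proof.
split=> [ind|free].
  apply: inj_row_free => v v0.
  pose c i := if pselect (i \in T) is left h then v 0 (enum_rank_in h i) else 0.
  have cE r : c (enum_val r) = v 0 r.
    rewrite /c; case: pselect => [h|/(_ (enum_valP r))//].
    by rewrite enum_valK_in.
  apply/rowP => r; rewrite mxE -cE; apply: ind (enum_valP r) => x /(nthP x)[l ls <-].
  have /rowP/(_ (Ordinal ls)) := v0; rewrite !mxE; apply: etrans.
  rewrite big_enum_val; apply: eq_bigr => j _; rewrite cE mxE.
  by rewrite (tnth_nth x).
move=> c cF i iT.
pose v := \row_(r < #|T|) c (enum_val r).
suff /rowP/(_ (enum_rank_in iT i)) : v = 0 by rewrite !mxE enum_rankK_in.
apply/eqP; rewrite -(mulmx_free_eq0 _ free); apply/eqP/rowP => l.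
rewrite !mxE; under eq_bigr do rewrite !mxE.
rewrite -(big_enum_val (fun i => c i * F i _)); apply: cF.
exact: mem_tnth.
Qed.

(** * Subrings of functions and openness of independence *)

(** [C] holds of the constant functions and is closed under sums and products.
    This is used for continuity at a point and for polynomial functions. *)
Record fun_subring (R : comNzRingType) (X : Type) (C : (X -> R) -> Prop) : Prop :=
  FunSubring {
    fsr_cst : forall c, C (fun=> c);
    fsr_add : forall f g, C f -> C g -> C (fun x => f x + g x);
    fsr_mul : forall f g, C f -> C g -> C (fun x => f x * g x) }.

Section FunSubring.
Variables (R : comNzRingType) (X : Type) (C : (X -> R) -> Prop).
Hypothesis CR : fun_subring C.

Lemma fsr_ext f g : f =1 g -> C f -> C g.
Proof. by move=> /funext ->. Qed.

Lemma fsr_sum (I : Type) (r : seq I) (P : pred I) (F : I -> X -> R) :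
  (forall i, P i -> C (F i)) -> C (fun x => \sum_(i <- r | P i) F i x).
Proof.
move=> CF; elim: r => [|i r IH].
  by apply: (fsr_ext _ (fsr_cst CR 0)) => x; rewrite big_nil.
have [Pi|nPi] := boolP (P i); last first.
  by apply: (fsr_ext _ IH) => x; rewrite big_cons (negbTE nPi).
by apply: (fsr_ext _ (fsr_add CR (CF i Pi) IH)) => x; rewrite big_cons Pi.
Qed.

Lemma fsr_prod (I : Type) (r : seq I) (P : pred I) (F : I -> X -> R) :
  (forall i, P i -> C (F i)) -> C (fun x => \prod_(i <- r | P i) F i x).
Proof.
move=> CF; elim: r => [|i r IH].
  by apply: (fsr_ext _ (fsr_cst CR 1)) => x; rewrite big_nil.
have [Pi|nPi] := boolP (P i); last first.
  by apply: (fsr_ext _ IH) => x; rewrite big_cons (negbTE nPi).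
by apply: (fsr_ext _ (fsr_mul CR (CF i Pi) IH)) => x; rewrite big_cons Pi.
Qed.

Lemma fsr_opp f : C f -> C (fun x => - f x).
Proof.
by move=> Cf; apply: (fsr_ext _ (fsr_mul CR (fsr_cst CR (-1)) Cf)) => x; rewrite mulN1r.
Qed.

Lemma fsr_det n (M : X -> 'M[R]_n) :
  (forall i j, C (fun x => M x i j)) -> C (fun x => \det (M x)).
Proof.
move=> CM; apply: fsr_sum => s _; apply: (fsr_mul CR); first exact: (fsr_cst CR).
by apply: fsr_prod.
Qed.

Lemma fsr_adj n (M : X -> 'M[R]_n) i j :
  (forall i j, C (fun x => M x i j)) -> C (fun x => (\adj (M x)) i j).
Proof.
move=> CM; pose M' x := row' j (col' i (M x)).
have CM' : C (fun x => \det (M' x)).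
  by apply: fsr_det => i' j'; apply: fsr_ext (CM _ _) => x; rewrite !mxE.
by apply: (fsr_ext _ (fsr_mul CR (fsr_cst CR _) CM')) => x; rewrite mxE.
Qed.

Lemma fsr_mulmx m n p (M : X -> 'M[R]_(m, n)) (N : X -> 'M[R]_(n, p)) i j :
  (forall i j, C (fun x => M x i j)) -> (forall i j, C (fun x => N x i j)) ->
  C (fun x => (M x *m N x) i j).
Proof.
move=> CM CN; under eq_fun do rewrite mxE.
by apply: fsr_sum => k _; apply: fsr_mul.
Qed.
End FunSubring.

Lemma fun_subring_continuous (R : realType) (Y : topologicalType) (y0 : Y) :
  fun_subring (fun f : Y -> R => {for y0, continuous f}).
Proof.
split=> [c|f g|f g] /=; first exact: cst_continuous.
  by move=> cf cg; exact: continuousD.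
by move=> cf cg; exact: continuousM.
Qed.

Lemma near_neq0 (R : realType) (Y : topologicalType) (y0 : Y) (f : Y -> R) :
  {for y0, continuous f} -> f y0 != 0 -> \forall y \near y0, f y != 0.
Proof. by move=> cf f0; exact: (cvgr_neq0 _ cf f0). Qed.

(** Independence on finitely many points is an open condition: with a right
    inverse [Q] of the sample matrix at [y0], det (sample matrix * [Q]) is
    continuous and equal to 1 at [y0]. *)
Lemma indep_on_near (R : realType) (Y : topologicalType) (y0 : Y) (I : finType)
    (X : eqType) (T : {set I}) (F : Y -> I -> X -> R) (s : seq X) :
  (forall i x, i \in T -> x \in s -> {for y0, continuous (fun y => F y i x)}) ->
  indep_on (fun x => x \in s) T (F y0) ->
  \forall y \near y0, indep_on (fun x => x \in s) T (F y).
Proof.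
move=> cF /row_free_sample_mx/row_freeP[Q NQ].
have CR := fun_subring_continuous R y0.
have := @near_neq0 R Y y0 (fun y => \det (sample_mx T (F y) s *m Q)).
rewrite /= NQ det1 oner_neq0 => /(_ _ isT).
have h : {for y0, continuous (fun y => \det (sample_mx T (F y) s *m Q))}.
  apply: (fsr_det CR) => i j; apply: (fsr_mulmx CR) => [i' l|? ?]; last first.
    exact: (fsr_cst CR).
  have := cF (enum_val i') (tnth (in_tuple s) l) (enum_valP _) (mem_tnth _ _).
  by apply: (fsr_ext) => y; rewrite mxE.
move=> /(_ h); apply: filterS => y ny.
apply/row_free_sample_mx; rewrite /row_free eqn_leq rank_leq_row /=.
have uN : sample_mx T (F y) s *m Q \in unitmx by rewrite unitmxE unitfE.
by rewrite -{1}(mxrank_unit uN) mxrankM_maxl.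
Qed.

(** * Resolvents of matrices with nonnegative off-diagonal entries *)

(** [x] exceeds all the absolute column sums of [A]; in particular x - A is then
    strictly diagonally dominant by columns. *)
Definition dominates (R : realFieldType) (n : nat) (A : 'M[R]_n) (x : R) : Prop :=
  forall j, \sum_i `|A i j| < x.

Lemma dominates_ltr (R : realFieldType) (n : nat) (A : 'M[R]_n) :
  exists2 x0, 0 < x0 & forall x, x0 < x -> dominates A x.
Proof.
exists (1 + \sum_j \sum_i `|A i j|).
  by rewrite ltr_pwDl ?ltr01 // sumr_ge0 // => j _; rewrite sumr_ge0.
move=> x xA j; apply: le_lt_trans xA.
rewrite [leRHS](_ : _ = \sum_i `|A i j| + (1 + \sum_(l | l != j) \sum_i `|A i l|)).
  rewrite lerDl addr_ge0 ?ler01 //.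
  by rewrite sumr_ge0 // => l _; rewrite sumr_ge0.
by rewrite addrCA [in LHS](bigD1 j).
Qed.

Lemma dominates_le (R : realFieldType) (n : nat) (A B : 'M[R]_n) (x : R) :
  (forall i j, `|A i j| <= `|B i j|) -> dominates B x -> dominates A x.
Proof. by move=> AB Bx j; apply: le_lt_trans (Bx j); apply: ler_sum. Qed.

Lemma dominates_diag (R : realFieldType) (n : nat) (A : 'M[R]_n) (x : R) i :
  dominates A x -> A i i < x.
Proof.
move=> /(_ i); apply: le_lt_trans; rewrite (bigD1 i) //=.
by rewrite (le_trans (ler_norm _)) // lerDl sumr_ge0.
Qed.

Section Metzler.
Variables (R : realFieldType) (n : nat) (A : 'M[R]_n.+1) (x : R).
Hypothesis A_ge0 : forall i j, i != j -> 0 <= A i j.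
Hypothesis Ax : dominates A x.

Lemma mul_subM_coord (r : 'rV[R]_n.+1) j :
  (r *m (x%:M - A)) 0 j = r 0 j * x - \sum_i r 0 i * A i j.
Proof. by rewrite mulmxBr mul_mx_scalar !mxE mulrC. Qed.

(** A minimum principle: look at the least entry of [r]. *)
Lemma metzler_row_ge0 (r : 'rV[R]_n.+1) :
  (forall j, 0 <= (r *m (x%:M - A)) 0 j) -> forall j, 0 <= r 0 j.
Proof.
move=> rM j0.
have [j _ jmin] := arg_minP (fun j => r 0 j) (erefl (xpredT j0)).
apply: le_trans (jmin j0 isT); rewrite leNgt; apply/negP => rj.
have := rM j; rewrite mul_subM_coord subr_ge0; apply/negP; rewrite -ltNge.
apply: lt_le_trans (_ : r 0 j * \sum_i `|A i j| <= _).
  by rewrite ltr_nM2l.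
rewrite mulr_sumr; apply: ler_sum => i _.
have [->|ij] := eqVneq i j; first by rewrite ler_nM2l // ler_norm.
by rewrite ger0_norm ?A_ge0 // ler_wpM2r ?A_ge0 // jmin.
Qed.

Lemma metzler_unitmx : x%:M - A \in unitmx.
Proof.
rewrite -row_free_unit; apply: inj_row_free => v v0; apply/rowP => j; rewrite mxE.
apply/eqP; rewrite eq_le; apply/andP; split; last first.
  by apply: metzler_row_ge0 => l; rewrite v0 mxE.
have := @metzler_row_ge0 (- v); rewrite mulNmx v0 oppr0 => /(_ _ j).
by rewrite !mxE oppr_ge0; apply => l; rewrite mxE.
Qed.

Let G := invmx (x%:M - A).

Lemma metzler_inv_ge0 k i : 0 <= G k i.
Proof.
have := @metzler_row_ge0 (row k G); rewrite -row_mul mulVmx ?metzler_unitmx //.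
move=> /(_ _ i); rewrite mxE; apply => j.
by rewrite !mxE; case: eqP.
Qed.

(** A positive entry A j i is an edge i -> j, so the entry (k, i) of the inverse
    is positive as soon as k can be reached from i. *)
Lemma metzler_inv_gt0 k i : connect (fun i j => 0 < A j i) i k -> 0 < G k i.
Proof.
have E j : G k j * (x - A j j) = (k == j)%:R + \sum_(l | l != j) G k l * A l j.
  have := congr1 (fun M : 'M[R]_n.+1 => M k j) (mulVmx metzler_unitmx).
  rewrite -/G mulmxBr mul_mx_scalar !mxE (bigD1 j) //= => <-.
  by ring.
have pos j : 0 < G k j * (x - A j j) -> 0 < G k j.
  by rewrite pmulr_lgt0 // subr_gt0; exact: dominates_diag.
have S0 j : 0 <= \sum_(l | l != j) G k l * A l j.
  by apply: sumr_ge0 => l lj; rewrite mulr_ge0 ?metzler_inv_ge0 ?A_ge0.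
case/connectP => p; elim: p i => [|j p IH] i /= pth kE.
  by apply: pos; rewrite E kE eqxx ltr_pwDl // -kE.
case/andP: pth => Aji pth.
have [<-|ij] := eqVneq j i; first exact: IH.
apply: pos; rewrite E ltr_wpDl ?ler0n // (bigD1 j) //= ltr_pwDl //.
  by rewrite mulr_gt0 // IH.
by apply: sumr_ge0 => l /andP[lj _]; rewrite mulr_ge0 ?metzler_inv_ge0 ?A_ge0.
Qed.
End Metzler.

(** * Resolvent of a graph with an ear *)

Lemma mem_zip_uniqr (T : eqType) (x y y0 : T) (s t : seq T) :
  size s = size t -> uniq s ->
  ((x, y) \in zip s t) = (x \in s) && (y == nth y0 t (index x s)).
Proof.
move=> st us; apply/(nthP (x, y0))/andP => [[l]|[xs /eqP ->]].
  rewrite size1_zip ?st // => lt; rewrite nth_zip // => -[<- <-].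
  by rewrite mem_nth ?st // index_uniq ?st.
exists (index x s); first by rewrite size1_zip ?st // -st index_mem.
by rewrite nth_zip // nth_index.
Qed.

Lemma mem_zip_uniql (T : eqType) (x y x0 : T) (s t : seq T) :
  size s = size t -> uniq t ->
  ((x, y) \in zip s t) = (y \in t) && (x == nth x0 s (index y t)).
Proof.
move=> st us; apply/(nthP (x0, y))/andP => [[l]|[xs /eqP ->]].
  rewrite size1_zip ?st // => lt; rewrite nth_zip // => -[<- <-].
  by rewrite mem_nth ?st // index_uniq ?st.
exists (index y t); first by rewrite size1_zip ?st // index_mem.
by rewrite nth_zip // nth_index.
Qed.

Section Ear.
Variables (R : fieldType) (n : nat).
Local Notation o := (ord0 : 'I_n.+1).
Variables (A : 'M[R]_n.+1) (W : {set 'I_n.+1}) (p q : 'I_n.+1) (s : seq 'I_n.+1).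
Variables (b : 'I_n.+1 -> R) (w : R).

(** [A] with an ear p -> s -> q added: the entry (i, j) belongs to the edge
    j -> i. The vertices of [s] receive the diagonal entries [b], and the edges of
    the ear the weight 1, except the last one, which has weight [w]. *)
Definition ear_mx : 'M[R]_n.+1 := \matrix_(i, j)
  (A i j + (if (i == j) && (i \in s) then b i else 0)
   + (if (j, i) \in zip (p :: s) (rcons s q)
      then (if j == last p s then w else 1) else 0)).

Hypothesis oW : o \in W.
Hypothesis pW : p \in W.
Hypothesis qW : q \in W.
Hypothesis s_gt0 : (0 < size s)%N.
Hypothesis s_uniq : uniq s.
Hypothesis sW : {in s, forall v, v \notin W}.
Hypothesis A0 : forall i j, (i \notin W) || (j \notin W) -> A i j = 0.

Let ps_uniq : uniq (p :: s).
Proof. by rewrite /= s_uniq andbT; apply: contraL pW => /sW. Qed.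
Let sq_uniq : uniq (rcons s q).
Proof. by rewrite rcons_uniq s_uniq andbT; apply: contraL qW => /sW. Qed.
Let sz : size (p :: s) = size (rcons s q).
Proof. by rewrite size_rcons. Qed.

Lemma ear_neq_last l : (l < size s)%N -> nth o (p :: s) l != last p s.
Proof.
move=> ls; rewrite (last_nth o) nth_uniq //=; first by rewrite ltn_eqF.
exact: ltnW.
Qed.

Lemma ear_p_neq_last : p != last p s.
Proof. exact: (ear_neq_last s_gt0). Qed.

Variable x : R.
Hypothesis xb : {in s, forall m, x != b m}.

(* beta is the product of the diagonal entries of x - A over the ear. *)
Let beta := \prod_(m <- s) (x - b m).
Let beta_neq0 : beta != 0.
Proof. by rewrite prodf_seq_neq0; apply/allP => m /xb; rewrite subr_eq0. Qed.

(** The ear replaced by a single edge p -> q: the weight obtained by eliminating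
    the vertices of the ear from x - A depends on [x]. *)
Definition ear_eff : 'M[R]_n.+1 := A + (w / beta) *: delta_mx q p.

Section Row.
Variable V : 'rV[R]_n.+1.
Hypothesis Vx : V *m (x%:M - ear_mx) = delta_mx 0 o.

Let Vcol j : V 0 j * x =
  (o == j)%:R + \sum_i V 0 i * A i j + (if j \in s then b j * V 0 j else 0)
  + (if j \in p :: s then
       (if j == last p s then w else 1) * V 0 (nth o (rcons s q) (index j (p :: s)))
     else 0).
Proof.
have := congr1 (fun M : 'rV_n.+1 => M 0 j) Vx.
rewrite mulmxBr mul_mx_scalar !mxE eqxx /= eq_sym mulrC => /eqP.
rewrite subr_eq => /eqP ->; rewrite -!addrA; congr (_ + _).
transitivity (\sum_i (V 0 i * A i j +
  ((if i == j then (if j \in s then b j * V 0 j else 0) else 0)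
   + if (j, i) \in zip (p :: s) (rcons s q)
     then (if j == last p s then w else 1) * V 0 i else 0))).
  apply: eq_bigr => i _; rewrite mxE !mulrDr addrA; congr (_ + _ + _).
    by case: eqP => [->|]; rewrite /= ?mulr0 //; case: ifP; rewrite ?mulr0 // mulrC.
  by case: ifP; rewrite ?mulr0 // mulrC.
rewrite !big_split /=; congr (_ + (_ + _)).
  by rewrite -big_mkcond /= big_pred1_eq.
rewrite -big_mkcond /=.
rewrite (eq_bigl _ _ (fun i => mem_zip_uniqr j i o sz ps_uniq)).
case: (j \in p :: s); last by rewrite big_pred0.
by rewrite big_pred1_eq.
Qed.

(** The equations at the vertices of the ear, solved from its end. *)
Lemma ear_row_chain l : (l < size s)%N ->
  V 0 (nth o s l) * \prod_(m <- drop l s) (x - b m) = w * V 0 q.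
Proof.
have A0m i m : m \in s -> V 0 i * A i m = 0.
  by move=> /sW mW; rewrite A0 ?mW ?orbT // mulr0.
have step l' : (l' < size s)%N -> V 0 (nth o s l') * (x - b (nth o s l')) =
    (if l'.+1 == size s then w * V 0 q else V 0 (nth o s l'.+1)).
  move=> ls; set m := nth o s l'; have ms : m \in s by exact: mem_nth.
  have mW := sW ms.
  have om : o != m by apply: contraNneq mW => <-.
  have S0 : \sum_i V 0 i * A i m = 0 by rewrite big1 // => i _; rewrite A0m.
  rewrite mulrBr Vcol (negbTE om) S0 mulr0n !add0r ms inE ms orbT.
  rewrite [b m * _]mulrC addrAC subrr add0r.
  have -> : index m (p :: s) = l'.+1.
    by rewrite -[m]/(nth o (p :: s) l'.+1) index_uniq.
  rewrite /m nth_rcons -[nth o s l']/(nth o (p :: s) l'.+1) (last_nth o) nth_uniq //=.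
  by case: (ltngtP l'.+1 (size s)) ls => // _ _; rewrite mul1r.
move=> ls; have [k kE] : {k | (l + k.+1)%N = size s}.
  by exists (size s - l.+1)%N; rewrite addnS -addSn subnKC.
elim: k l ls kE => [|k IH] l ls kE; rewrite (drop_nth o ls) big_cons mulrA step //.
  by rewrite drop_oversize ?big_nil ?mulr1 -?kE ?addn1 ?eqxx.
have ls1 : (l.+1 < size s)%N by rewrite -kE addnS ltnS addnS ltnS leq_addr.
by rewrite ltn_eqF // IH // addSnnS.
Qed.

(** The restriction to [W] of the first row of the resolvent solves the system
    of the contracted graph. *)
Lemma ear_row_eff :
  (\row_j if j \in W then V 0 j else 0) *m (x%:M - ear_eff) = delta_mx 0 o.
Proof.
apply/rowP => j; rewrite mulmxBr mul_mx_scalar !mxE eqxx /= [j == _]eq_sym.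
have -> : \sum_i (\row_j (if j \in W then V 0 j else 0)) 0 i * ear_eff i j =
    \sum_i V 0 i * A i j + (if j == p then w / beta * V 0 q else 0).
  transitivity (\sum_i (V 0 i * A i j + if i == q then
      (if j == p then w / beta * V 0 q else 0) else 0)).
    apply: eq_bigr => i _; rewrite !mxE mulrDr; congr (_ + _).
      by case: ifP => // /negbT iW; rewrite A0 ?iW // !mulr0.
    have [->|] := eqVneq i q; last by rewrite !mulr0.
    by rewrite qW /=; case: eqP => _; rewrite ?mulr0 // mulr1 mulrC.
  by rewrite big_split /= -big_mkcond /= big_pred1_eq.
case: ifP => jW; last first.
  have oj : o != j by apply: contraTneq oW => ->; rewrite jW.
  rewrite big1 ?add0r; last by move=> i _; rewrite A0 ?jW ?orbT // mulr0.
  have jp : j != p by apply: contraTneq pW => <-; rewrite jW.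
  by rewrite (negbTE jp) mulr0 subr0 (negbTE oj).
have js : j \notin s by apply: contraL jW => /sW.
rewrite mulrC Vcol (negbTE js) addr0 inE (negbTE js) orbF.
have [->|jp] := eqVneq j p; last by rewrite !addr0 addrK.
rewrite (negbTE ear_p_neq_last) mul1r /= eqxx nth_rcons s_gt0.
have := ear_row_chain s_gt0; rewrite drop0 -/beta => E.
have -> : w / beta * V 0 q = V 0 (nth o s 0).
  by rewrite mulrAC -E mulfK.
by rewrite -[X in X - _]addrA addrK.
Qed.
End Row.

Section Col.
Variable U : 'cV[R]_n.+1.
Hypothesis Ux : (x%:M - ear_mx) *m U = delta_mx o 0.

Let Urow i : U i 0 * x =
  (o == i)%:R + \sum_j A i j * U j 0 + (if i \in s then b i * U i 0 else 0)
  + (if i \in rcons s q then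
       let j := nth o (p :: s) (index i (rcons s q)) in
       (if j == last p s then w else 1) * U j 0
     else 0).
Proof.
have := congr1 (fun M : 'cV_n.+1 => M i 0) Ux.
rewrite mulmxBl mul_scalar_mx !mxE eqxx andbT /= eq_sym mulrC => /eqP.
rewrite subr_eq => /eqP ->; rewrite -!addrA; congr (_ + _).
transitivity (\sum_j (A i j * U j 0 +
  ((if j == i then (if i \in s then b i * U i 0 else 0) else 0)
   + if (j, i) \in zip (p :: s) (rcons s q)
     then (if j == last p s then w else 1) * U j 0 else 0))).
  apply: eq_bigr => j _; rewrite mxE !mulrDl addrA; congr (_ + _ + _).
    by rewrite eq_sym; case: eqP => [->|]; rewrite /= ?mul0r //; case: ifP; rewrite ?mul0r.
  by case: ifP; rewrite ?mul0r.
rewrite !big_split /=; congr (_ + (_ + _)).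
  by rewrite -big_mkcond /= big_pred1_eq.
rewrite -big_mkcond /=.
rewrite (eq_bigl _ _ (fun j => mem_zip_uniql j i o sz sq_uniq)).
case: (i \in rcons s q); last by rewrite big_pred0.
by rewrite big_pred1_eq.
Qed.

(** The equations at the vertices of the ear, solved from its beginning. *)
Lemma ear_col_chain l : (l <= size s)%N ->
  U (nth o (p :: s) l) 0 * \prod_(m <- take l s) (x - b m) = U p 0.
Proof.
elim: l => [|l IH] ls; first by rewrite take0 big_nil mulr1.
rewrite (take_nth o ls) -cats1 big_cat big_seq1 /= mulrCA -[RHS](IH (ltnW ls)) mulrC.
congr (_ * _); set m := nth o s l; have ms : m \in s by exact: mem_nth.
have mW := sW ms.
have om : o != m by apply: contraNneq mW => <-.
have A0m j : A m j * U j 0 = 0 by rewrite A0 ?mW // mul0r.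
have S0 : \sum_j A m j * U j 0 = 0 by rewrite big1.
rewrite mulrBr Urow (negbTE om) S0 mulr0n !add0r ms mem_rcons inE ms orbT.
rewrite [b m * _]mulrC addrAC subrr add0r.
have -> : index m (rcons s q) = l.
  have -> : m = nth o (rcons s q) l by rewrite nth_rcons ls.
  by rewrite index_uniq // size_rcons ltnW.
by rewrite /= (negbTE (ear_neq_last ls)) mul1r.
Qed.

Lemma ear_last_chain : U (last p s) 0 * beta = U p 0.
Proof. by rewrite (last_nth o) -(ear_col_chain (leqnn _)) take_size. Qed.

Lemma ear_col_eff :
  (x%:M - ear_eff) *m (\col_i if i \in W then U i 0 else 0) = delta_mx o 0.
Proof.
apply/colP => i; rewrite mulmxBl mul_scalar_mx !mxE eqxx andbT /= [i == _]eq_sym.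
have -> : \sum_j ear_eff i j * (\col_j (if j \in W then U j 0 else 0)) j 0 =
    \sum_j A i j * U j 0 + (if i == q then w / beta * U p 0 else 0).
  transitivity (\sum_j (A i j * U j 0 + if j == p then
      (if i == q then w / beta * U p 0 else 0) else 0)).
    apply: eq_bigr => j _; rewrite !mxE mulrDl; congr (_ + _).
      by case: ifP => // /negbT jW; rewrite A0 ?jW ?orbT // !mul0r.
    have [->|] := eqVneq j p; last by rewrite andbF mulr0 mul0r.
    by rewrite pW andbT; case: eqP => _; rewrite ?mulr0 ?mul0r // mulr1.
  by rewrite big_split /= -big_mkcond /= big_pred1_eq.
case: ifP => iW; last first.
  have oi : o != i by apply: contraTneq oW => ->; rewrite iW.
  rewrite big1 ?add0r; last by move=> j _; rewrite A0 ?iW // mul0r.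
  have iq : i != q by apply: contraTneq qW => <-; rewrite iW.
  by rewrite (negbTE iq) mulr0 subr0 (negbTE oi).
have js : i \notin s by apply: contraL iW => /sW.
rewrite mulrC Urow (negbTE js) addr0 mem_rcons inE (negbTE js) orbF.
have [->|jp] := eqVneq i q; last by rewrite !addr0 addrK.
have -> : index q (rcons s q) = size s.
  by rewrite -cats1 index_cat (negbTE (contraL (@sW q) _)) ?qW //= ?eqxx ?addn0.
rewrite -(last_nth o); cbv zeta; rewrite eqxx -ear_last_chain.
have -> : w / beta * (U (last p s) 0 * beta) = w * U (last p s) 0.
  by rewrite mulrACA mulVf // mulr1.
by rewrite -[X in X - _]addrA addrK.
Qed.
End Col.

Hypothesis unit1 : x%:M - ear_mx \in unitmx.
Hypothesis unit2 : x%:M - ear_eff \in unitmx.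
Let G1 := invmx (x%:M - ear_mx).
Let G2 := invmx (x%:M - ear_eff).

Let G1row : row o G1 *m (x%:M - ear_mx) = delta_mx 0 o.
Proof. by rewrite -row_mul mulVmx // row1. Qed.
Let G1col : (x%:M - ear_mx) *m col o G1 = delta_mx o 0.
Proof. by rewrite colE mulmxA mulmxV // mul1mx. Qed.

(** On the old vertices the first row and the first column of the resolvent are
    those of the contracted graph. *)
Lemma ear_resolvent_row i : i \in W -> G1 o i = G2 o i.
Proof.
move=> iW; have := ear_row_eff G1row => /(congr1 (mulmx^~ G2)).
rewrite mulmxK // -rowE => /rowP/(_ i); rewrite !mxE iW => <- //.
Qed.

Lemma ear_resolvent_col i : i \in W -> G1 i o = G2 i o.
Proof.
move=> iW; have := ear_col_eff G1col => /(congr1 (mulmx G2)).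
by rewrite mulKmx // -colE => /colP/(_ i); rewrite !mxE iW => <-.
Qed.

(** The function of a diagonal entry of the ear carries a factor [w], coming from
    the last edge. *)
Lemma ear_resolvent_loop m : m \in s ->
  G1 o m * G1 m o = w * (G2 o q * G2 p o / (beta * (x - b m))).
Proof.
move=> ms; have ls : (index m s < size s)%N by rewrite index_mem.
have := ear_row_chain G1row ls; have := ear_col_chain G1col (ls : (index m s).+1 <= _)%N.
rewrite /= nth_index // (take_nth o) // (drop_nth o) //= nth_index //.
rewrite -cats1 big_cat big_seq1 big_cons /= !mxE.
rewrite (ear_resolvent_row qW) (ear_resolvent_col pW) => <- E.
have bE : beta = \prod_(i <- take (index m s) s) (x - b i) *
   ((x - b m) * \prod_(j <- drop (index m s).+1 s) (x - b j)).
  rewrite /beta -{1}(cat_take_drop (index m s) s) big_cat /=; congr (_ * _).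
  by rewrite (drop_nth o) // big_cons nth_index.
move: beta_neq0; rewrite bE !mulf_eq0 !negb_or => /and3P[T0 y0 D0].
rewrite [w * _]mulrA [w * _]mulrA -E; field.
by rewrite y0 D0 T0.
Qed.

Lemma ear_resolvent_last :
  G1 o q * G1 (last p s) o = G2 o q * G2 p o / beta.
Proof.
rewrite (ear_resolvent_row qW) -(ear_resolvent_col pW).
have := ear_last_chain G1col; rewrite !mxE => <-.
by rewrite mulrA mulfK.
Qed.
End Ear.

(** * Independence in the limit of a weak ear *)

Lemma poly_eq0_gt (R : realFieldType) (P : {poly R}) (x0 : R) :
  (forall x, x0 < x -> P.[x] = 0) -> P = 0.
Proof.
move=> P0; apply/eqP; apply: contraT => nP.
pose rs := [seq x0 + i.+1%:R | i <- iota 0 (size P)].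
have := @max_poly_roots _ P rs nP; rewrite size_map size_iota ltnn; apply.
  by apply/allP => _ /mapP[i _ ->]; apply/eqP/P0; rewrite ltrDl ltr0n.
rewrite map_inj_uniq ?iota_uniq // => i j /addrI /eqP.
by rewrite eqr_nat => /eqP[].
Qed.

Lemma map_char_poly_mx_horner (R : comNzRingType) (n : nat) (A : 'M[R]_n) (x : R) :
  map_mx (horner_eval x) (char_poly_mx A) = x%:M - A.
Proof.
rewrite /char_poly_mx map_mxB map_scalar_mx /= /horner_eval hornerX; congr (_ - _).
by apply/matrixP => i j; rewrite !mxE hornerC.
Qed.

Lemma horner_char_poly (R : comNzRingType) (n : nat) (A : 'M[R]_n) (x : R) :
  (char_poly A).[x] = \det (x%:M - A).
Proof. by rewrite -map_char_poly_mx_horner det_map_mx. Qed.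

Lemma horner_adj_char_poly_mx (R : comNzRingType) (n : nat) (A : 'M[R]_n) (x : R) i j :
  (\adj (char_poly_mx A) i j).[x] = \adj (x%:M - A) i j.
Proof. by rewrite -map_char_poly_mx_horner -map_mx_adj [RHS]mxE. Qed.

Lemma adj_invmx (R : comUnitRingType) (n : nat) (M : 'M[R]_n) :
  M \in unitmx -> \adj M = \det M *: invmx M.
Proof. by move=> uM; rewrite /invmx uM scalerA divrr ?scale1r. Qed.

(** The inverse of x - A; [invmx] returns its argument when x - A is singular, so
    this is only used at points where it is invertible. *)
Definition resolvent (R : comUnitRingType) (n : nat) (A : 'M[R]_n) (x : R) : 'M[R]_n :=
  invmx (x%:M - A).

(** For [e = (j, i)], the function G_1i(x) G_j1(x), where G is the resolvent of
    [A]. It is the derivative of the transfer function G_11 with respect to the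
    entry A i j, the weight of the edge j -> i, or a diagonal entry if i = j. *)
Definition edge_response (R : comUnitRingType) (n : nat) (A : 'M[R]_n.+1)
    (e : 'I_n.+1 * 'I_n.+1) (x : R) : R :=
  resolvent A x ord0 e.2 * resolvent A x e.1 ord0.

Lemma sum_setU (V : nmodType) (I : finType) (B C : {set I}) (f : I -> V) :
  {in C, forall i, i \notin B} ->
  \sum_(i in B :|: C) f i = \sum_(i in B) f i + \sum_(i in C) f i.
Proof.
move=> CB; rewrite -bigU /=; last first.
  by rewrite disjoint_sym disjoint_subset; apply/fintype.subsetP => i /CB.
by apply: eq_bigl => i; rewrite !inE.
Qed.

Section IndepEar.
Variables (R : realFieldType) (n : nat).
Local Notation o := (ord0 : 'I_n.+1).
Variables (A : 'M[R]_n.+1) (T : {set 'I_n.+1 * 'I_n.+1}) (W : {set 'I_n.+1}).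
Variables (p q : 'I_n.+1) (s : seq 'I_n.+1) (b : 'I_n.+1 -> R) (x0 : R).
Hypothesis qW : q \in W.
Hypothesis s_gt0 : (0 < size s)%N.
Hypothesis s_uniq : uniq s.
Hypothesis sW : {in s, forall v, v \notin W}.
Hypothesis TW : {in T, forall e, (e.1 \in W) && (e.2 \in W)}.

(** The entries selected after adding an ear: the old ones, the diagonal entries
    of the ear and its last edge. The ear adds as many entries as it has edges. *)
Definition ear_basis : {set 'I_n.+1 * 'I_n.+1} :=
  T :|: ([set (m, m) | m in s] :|: [set (last p s, q)]).

(** The functions of the entries in [ear_basis], computed on the contracted
    graph, those of the new diagonal entries being divided by [w]; unlike
    the functions themselves, these are still independent at w = 0. *)
Definition ear_response (w : R) (e : 'I_n.+1 * 'I_n.+1) (x : R) : R :=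
  let beta := \prod_(m <- s) (x - b m) in
  let H := x%:M - ear_eff A p q s b w x in
  if e \in T then invmx H o e.2 * invmx H e.1 o
  else invmx H o q * invmx H p o / (beta * if e.1 == e.2 then x - b e.1 else 1).

Let last_s : last p s \in s.
Proof. by case: s s_gt0 => //= a l _; rewrite mem_last. Qed.

Let notT m i : m \in s -> (m, i) \notin T.
Proof. by move=> /sW mW; apply/negP => /TW; rewrite (negbTE mW). Qed.

Let last_neq : (last p s == q) = false.
Proof. by apply/negbTE; apply: contraNneq (sW last_s) => ->. Qed.

Lemma big_ear_basis (V : nmodType) (f : 'I_n.+1 * 'I_n.+1 -> V) :
  \sum_(e in ear_basis) f e =
  \sum_(e in T) f e + (\sum_(m <- s) f (m, m) + f (last p s, q)).
Proof.
rewrite /ear_basis sum_setU; last first.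
  move=> e; rewrite !inE => /orP[/imsetP[m ms ->]|/eqP ->]; exact: notT.
rewrite sum_setU ?big_set1; last first.
  move=> e; rewrite inE => /eqP ->; apply/imsetP => -[m _ [E1 E2]].
  by move: last_neq; rewrite E1 E2 eqxx.
by rewrite big_imset /= -?big_uniq // => m m' _ _ [].
Qed.

Lemma card_ear_basis : #|ear_basis| = (#|T| + (size s).+1)%N.
Proof.
rewrite -[LHS]sum1_card; apply: etrans (big_ear_basis (fun=> 1%N)) _.
by rewrite -[in RHS]sum1_card -[size s]sum1_size; congr addn; exact: addn1.
Qed.

Hypothesis indA : indep_on (dominates A) T (edge_response A).
Hypothesis unitA : forall x, dominates A x -> x%:M - A \in unitmx.
Hypothesis x0A : forall x, x0 < x -> dominates A x.
Hypothesis x0b : forall m x, m \in s -> x0 < x -> b m < x.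
Hypothesis b_inj : {in s &, injective b}.
Hypothesis bA : forall m, m \in s -> \adj ((b m)%:M - A) o q * \adj ((b m)%:M - A) p o != 0.

(** Independence in the limit w = 0, where the contracted graph is the old one.
    Clearing denominators turns a relation into the vanishing of the polynomial
    P1 B^2 + h (sum_m c_m B / (X - b_m) + c_L B). Its value at b_m gives c_m = 0,
    and after division by B its value at one b_m gives c_L = 0. *)
Lemma indep_ear0 :
  indep_on (fun x => x0 < x) ear_basis (ear_response 0).
Proof.
move=> c cF.
pose a i := \adj (char_poly_mx A) o i; pose a' j := \adj (char_poly_mx A) j o.
pose B : {poly R} := \prod_(m <- s) ('X - (b m)%:P).
pose Bm m : {poly R} := \prod_(m' <- rem m s) ('X - (b m')%:P).
pose P1 := \sum_(e in T) c e *: (a e.2 * a' e.1).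
pose h := a q * a' p.
pose cL := c (last p s, q).
pose Q := P1 * B ^+ 2 + h * (\sum_(m <- s) c (m, m) *: Bm m + cL *: B).
have BE x : B.[x] = \prod_(m <- s) (x - b m).
  by rewrite horner_prod; apply: eq_bigr => m _; rewrite hornerXsubC.
have BmE m : m \in s -> B = ('X - (b m)%:P) * Bm m.
  by move=> ms; rewrite /B (perm_big _ (perm_to_rem ms)) big_cons.
have aE x i : dominates A x -> (a i).[x] = \det (x%:M - A) * resolvent A x o i.
  by move=> /unitA ux; rewrite horner_adj_char_poly_mx adj_invmx // mxE.
have a'E x i : dominates A x -> (a' i).[x] = \det (x%:M - A) * resolvent A x i o.
  by move=> /unitA ux; rewrite horner_adj_char_poly_mx adj_invmx // mxE.
have P1E x : dominates A x ->
    P1.[x] = \det (x%:M - A) ^+ 2 * \sum_(e in T) c e * edge_response A e x.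
  move=> Ax; rewrite horner_sum mulr_sumr; apply: eq_bigr => e _.
  by rewrite hornerZ hornerM aE // a'E // /edge_response; ring.
(* Q is det (x - A)^2 beta(x)^2 times the given relation. *)
have Q0 : Q = 0.
  apply: (@poly_eq0_gt _ _ x0) => x x0x; have Ax := x0A x0x.
  have bx m : m \in s -> x - b m != 0.
    by move=> ms; rewrite subr_eq0 gt_eqF // x0b.
  have B0 : B.[x] != 0.
    by rewrite BE prodf_seq_neq0; apply/allP => m ms; rewrite /= bx.
  pose g := resolvent A x o q * resolvent A x p o.
  have respE e : ear_response 0 e x = if e \in T then edge_response A e x
      else g / (B.[x] * if e.1 == e.2 then x - b e.1 else 1).
    by rewrite /ear_response /ear_eff mul0r scale0r addr0 -BE.
  pose S := \sum_(m <- s) c (m, m) * (Bm m).[x].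
  have S1 : \sum_(m <- s) c (m, m) * ear_response 0 (m, m) x = g / B.[x] ^+ 2 * S.
    rewrite mulr_sumr big_seq [RHS]big_seq; apply: eq_bigr => m ms.
    rewrite respE (negbTE (notT _ ms)) eqxx; have := B0; rewrite (BmE _ ms).
    rewrite hornerM hornerXsubC mulf_eq0 negb_or => /andP[h1 h2]; field.
    by rewrite h1 h2.
  have := cF x x0x; rewrite big_ear_basis S1 respE (negbTE (notT _ last_s)) last_neq.
  rewrite (eq_bigr (fun e => c e * edge_response A e x)) => [E|e eT]; last first.
    by rewrite respE eT.
  have -> : Q.[x] = \det (x%:M - A) ^+ 2 * B.[x] ^+ 2 *
     (\sum_(e in T) c e * edge_response A e x
       + (g / B.[x] ^+ 2 * S + cL * (g / (B.[x] * 1)))).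
    rewrite /Q hornerD !hornerM hornerD hornerZ P1E // aE // a'E //.
    rewrite horner_sum (eq_bigr (fun m => c (m, m) * (Bm m).[x])); last first.
      by move=> m _; rewrite hornerZ.
    rewrite -/S -[resolvent A x o q]/(resolvent A x o q); rewrite /g.
    move: B0; move: B.[x] => B'; move: (\sum_(e in T) _) => ST B0.
    by field.
  by rewrite E mulr0.
have Bb m : m \in s -> B.[b m] = 0.
  by move=> ms; rewrite (BmE _ ms) hornerM hornerXsubC subrr mul0r.
have hb m : m \in s -> h.[b m] != 0.
  by move=> ms; rewrite hornerM !horner_adj_char_poly_mx bA.
have Bmb m : m \in s -> (Bm m).[b m] != 0.
  move=> ms; rewrite horner_prod prodf_seq_neq0; apply/allP => m' /=.
  rewrite mem_rem_uniq // inE => /andP[mm' m's].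
  by rewrite hornerXsubC subr_eq0; apply: contraNneq mm' => /b_inj ->.
have c1 m : m \in s -> c (m, m) = 0.
  move=> ms; have := congr1 (fun P : {poly R} => P.[b m]) Q0.
  rewrite /= /Q hornerD (hornerM P1) expr2 (hornerM B) (hornerM h) hornerD hornerZ.
  rewrite horner0 Bb // !mulr0 add0r addr0.
  rewrite horner_sum (big_rem m) //= big1_seq.
    rewrite addr0 hornerZ => /eqP; rewrite !mulf_eq0 (negbTE (hb _ ms)).
    by rewrite (negbTE (Bmb _ ms)) orbF => /eqP.
  move=> m' /=; rewrite mem_rem_uniq // inE => /andP[mm' m's].
  rewrite hornerZ /Bm (big_rem m) /=; last by rewrite mem_rem_uniq // inE eq_sym mm'.
  by rewrite hornerM hornerXsubC subrr mul0r mulr0.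
have B0 : B != 0 by rewrite monic_neq0 // monic_prod_XsubC.
have Q1 : P1 * B + cL *: h = 0.
  apply: (mulIf B0); rewrite mul0r -[RHS]Q0 /Q big1_seq ?add0r.
    by rewrite mulrDl -mulrA -expr2 -!scalerAl -scalerAr.
  by move=> m /= ms; rewrite c1 // scale0r.
have cL0 : cL = 0.
  have := congr1 (fun P : {poly R} => P.[b (last p s)]) Q1.
  rewrite /= hornerD hornerM hornerZ Bb // mulr0 add0r horner0.
  by move/eqP; rewrite mulf_eq0 (negbTE (hb _ last_s)) orbF => /eqP.
have P10 : P1 = 0.
  by apply: (mulIf B0); rewrite mul0r -[RHS]Q1 cL0 scale0r addr0.
move=> e; rewrite !inE => /or3P[|/imsetP[m ms ->]|/eqP ->] //; last exact: c1.
apply: indA => x Ax; have := P1E x Ax; rewrite P10 horner0 => /esym/eqP.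
rewrite mulf_eq0 expf_eq0 /=; have := unitA Ax.
by rewrite unitmxE unitfE => /negbTE -> /= /eqP.
Qed.
End IndepEar.

(** * Connectivity of graphs built by ears *)

Lemma mem_ear_zip (T : eqType) (p q i j : T) (s : seq T) :
  (0 < size s)%N -> uniq (p :: s) -> uniq (rcons s q) ->
  (j, i) \in zip (p :: s) (rcons s q) ->
  [/\ j \in p :: s, i \in rcons s q, (j \in s) || (i \in s) & i != j].
Proof.
move=> s0 ups usq; have sz : size (p :: s) = size (rcons s q) by rewrite size_rcons.
rewrite (mem_zip_uniqr _ _ p) // => /andP[jps /eqP iE].
have [k ks jE] := nthP p jps.
have kE : index j (p :: s) = k by rewrite -jE index_uniq.
split=> //.
- by rewrite iE mem_nth // -sz index_mem.
- move: jps; rewrite inE => /orP[/eqP jp|->//].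
  by rewrite iE jp /= eqxx nth_rcons s0 mem_nth ?orbT.
- rewrite iE kE; case: k ks jE {kE} => [_ <- /=|k ks <-].
    rewrite nth_rcons s0; apply: contraTneq ups => /= E.
    by rewrite -{1}E mem_nth.
  have -> : nth p (p :: s) k.+1 = nth p (rcons s q) k.
    by rewrite /= nth_rcons (ks : (k < size s)%N).
  rewrite nth_uniq //; first by rewrite gtn_eqF.
  all: by rewrite -sz // ltnW.
Qed.

Lemma mem_ear_last (T : eqType) (p q : T) (s : seq T) :
  uniq (p :: s) -> (last p s, q) \in zip (p :: s) (rcons s q).
Proof.
move=> ups; have sz : size (p :: s) = size (rcons s q) by rewrite size_rcons.
rewrite (mem_zip_uniqr _ _ p) // mem_last andTb.
by rewrite index_last // nth_rcons ltnn eqxx.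
Qed.

(** The first step of the construction is an ear from vertex 1 to itself, added
    to the graph without edges. *)
Lemma ear_graph_closed_ind (n : nat)
    (P : {set 'I_n.+1} -> {set 'I_n.+1 * 'I_n.+1} -> Prop) :
  P [set ord0]%SET finset.set0 ->
  (forall W E p q s, P W E -> p \in W -> q \in W -> (0 < size s)%N -> uniq s ->
     {in s, forall v, v \notin W} -> P (W :|: [set:: s])%SET (E :|: ear_edges p s q)%SET) ->
  forall W E, ear_graph W E -> P W E.
Proof.
move=> P0 PS W E; elim=> {W E} [s s0 us os|W E p q s _ PWE pW qW s0 us sW].
  rewrite -[ear_edges _ _ _]finset.set0U; apply: PS => //; rewrite ?inE // => v vs.
  by rewrite inE; apply: contraNneq os => <-.
exact: PS.
Qed.

Lemma ear_path (T : eqType) (e : rel T) (p q : T) (s : seq T) :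
  (forall x y, (x, y) \in zip (p :: s) (rcons s q) -> e x y) -> path e p (rcons s q).
Proof.
elim: s p => [|a s IH] p h /=; first by rewrite h ?mem_head.
rewrite h ?mem_head //=; apply: IH => x y xy; apply: h.
by rewrite inE xy orbT.
Qed.

(** [E] is a loop-free, strongly connected graph with vertex set [W], and vertex
    1 belongs to it. *)
Definition wired (n : nat) (W : {set 'I_n.+1}) (E : {set 'I_n.+1 * 'I_n.+1}) : Prop :=
  [/\ ord0 \in W,
      {in E, forall e, [/\ e.1 \in W, e.2 \in W & e.1 != e.2]} &
      {in W &, forall i j, connect (fun x y => (x, y) \in E) i j}].

Lemma wired0 (n : nat) : wired [set (ord0 : 'I_n.+1)]%SET finset.set0.
Proof.
split=> [|e|i j]; rewrite ?inE //.
by move=> /eqP -> /eqP ->; exact: connect0.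
Qed.

Lemma wired_ear (n : nat) (W : {set 'I_n.+1}) (E : {set 'I_n.+1 * 'I_n.+1})
    (p q : 'I_n.+1) (s : seq 'I_n.+1) :
  wired W E -> p \in W -> q \in W -> (0 < size s)%N -> uniq s ->
  {in s, forall v, v \notin W} ->
  wired (W :|: [set:: s])%SET (E :|: ear_edges p s q)%SET.
Proof.
move=> [oW EW conE] pW qW s0 us sW.
have ups : uniq (p :: s) by rewrite /= us andbT; apply: contraL pW => /sW.
have usq : uniq (rcons s q) by rewrite rcons_uniq us andbT; apply: contraL qW => /sW.
split=> [|[j i]|].
- by rewrite inE oW.
- rewrite inE => /orP[/EW[/= h1 h2 h3]|]; first by rewrite !inE h1 h2.
  rewrite inE => /(mem_ear_zip s0 ups usq)[].
  rewrite mem_rcons !inE /= => h1 h2 _ ij; split=> //; last by rewrite eq_sym.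
    by case/orP: h1 => [/eqP ->|->]; rewrite ?pW ?orbT.
  by case/orP: h2 => [/eqP ->|->]; rewrite ?qW ?orbT.
pose e x y := (x, y) \in (E :|: ear_edges p s q)%SET.
have pth : path e p (rcons s q).
  by apply: ear_path => x y xy; rewrite /e !inE xy orbT.
have conE' i j : i \in W -> j \in W -> connect e i j.
  move=> iW jW; apply: connect_sub (conE i j iW jW) => x y xy.
  by apply: connect1; rewrite /e inE xy.
have pm m : m \in s -> connect e p m.
  by move=> ms; apply: (path_connect pth); rewrite inE mem_rcons inE ms !orbT.
have mq m : m \in s -> connect e m q.
  move=> ms; case/splitPr: ms pth => s1 s2.
  rewrite rcons_cat /= cat_path /= => /and3P[_ _ pth].
  by apply/connectP; exists (rcons s2 q) => //; rewrite last_rcons.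
have out i : i \in (W :|: [set:: s])%SET -> exists2 i', i' \in W & connect e i i'.
  by rewrite !inE => /orP[iW|/mq]; [exists i | exists q].
have inn i : i \in (W :|: [set:: s])%SET -> exists2 i', i' \in W & connect e i' i.
  by rewrite !inE => /orP[iW|/pm]; [exists i | exists p].
move=> i j /out[i' i'W ii'] /inn[j' j'W jj'].
exact: connect_trans ii' (connect_trans (conE' _ _ i'W j'W) jj').
Qed.

(** * Induction on the ears *)

(** [A] is carried by the graph (W, E), with positive entries on the edges, and
    [T] is a set of more than |E| edges and diagonal entries whose functions are
    linearly independent. The diagonal entries of [A] on [W] are unconstrained. *)
Record certificate (R : realFieldType) (n : nat) (W : {set 'I_n.+1})
    (E : {set 'I_n.+1 * 'I_n.+1}) (A : 'M[R]_n.+1)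
    (T : {set 'I_n.+1 * 'I_n.+1}) : Prop := Certificate {
  cert_edge : forall i j, (j, i) \in E -> 0 < A i j;
  cert_nonedge : forall i j, i != j -> (j, i) \notin E -> A i j = 0;
  cert_out : forall i j, (i \notin W) || (j \notin W) -> A i j = 0;
  cert_basis : {in T, forall e, (e \in E) || (e.1 == e.2) && (e.1 \in W)};
  cert_card : (#|E| < #|T|)%N;
  cert_indep : indep_on (dominates A) T (edge_response A) }.

Section Certificate.
Variables (R : realFieldType) (n : nat) (W : {set 'I_n.+1})
    (E : {set 'I_n.+1 * 'I_n.+1}) (A : 'M[R]_n.+1) (T : {set 'I_n.+1 * 'I_n.+1}).
Hypothesis WE : wired W E.
Hypothesis CA : certificate W E A T.

Lemma certificate_ge0 i j : i != j -> 0 <= A i j.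
Proof.
move=> ij; have [/(cert_edge CA)/ltW //|/(cert_nonedge CA ij) ->] := boolP ((j, i) \in E).
by [].
Qed.

Lemma certificate_resolvent_gt0 x i j : dominates A x -> i \in W -> j \in W ->
  0 < resolvent A x j i.
Proof.
case: WE => _ _ conE Ax iW jW; apply: metzler_inv_gt0 => //.
  exact: certificate_ge0.
apply: connect_sub (conE i j iW jW) => u v uv; apply: connect1.
exact: (cert_edge CA).
Qed.

Lemma certificate_unitmx x : dominates A x -> x%:M - A \in unitmx.
Proof. by apply: metzler_unitmx; exact: certificate_ge0. Qed.
End Certificate.

Lemma certificate0 (R : realFieldType) (n : nat) :
  certificate [set (ord0 : 'I_n.+1)]%SET finset.set0 (0 : 'M[R]_n.+1)
    [set (ord0, ord0)]%SET.
Proof.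
split=> [i j|i j _ _|i j _|e||].
- by rewrite inE.
- by rewrite mxE.
- by rewrite mxE.
- by rewrite !inE => /eqP -> /=; rewrite !eqxx.
- by rewrite cards0 cards1.
have [x0 x0_gt0 dom] := dominates_ltr (0 : 'M[R]_n.+1).
move=> c /(_ (x0 + 1)) cF e; rewrite inE => /eqP ->.
have : dominates (0 : 'M[R]_n.+1) (x0 + 1) by apply: dom; rewrite ltrDl ltr01.
move=> /cF; rewrite big_set1 /edge_response /resolvent subr0 invmx_scalar !mxE eqxx /=.
have x1 : x0 + 1 != 0 by rewrite gt_eqF // addr_gt0 // ltr01.
by move/eqP; rewrite mulf_eq0 mulr1n mulf_eq0 !invr_eq0 orbb (negbTE x1) orbF => /eqP.
Qed.

Section EarStep.
Variables (R : realType) (n : nat) (W : {set 'I_n.+1})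
    (E : {set 'I_n.+1 * 'I_n.+1}) (A : 'M[R]_n.+1) (T : {set 'I_n.+1 * 'I_n.+1}).
Hypothesis WE : wired W E.
Hypothesis CA : certificate W E A T.
Variables (p q : 'I_n.+1) (s : seq 'I_n.+1).
Hypothesis pW : p \in W.
Hypothesis qW : q \in W.
Hypothesis s0 : (0 < size s)%N.
Hypothesis us : uniq s.
Hypothesis sW : {in s, forall v, v \notin W}.
Variable b : 'I_n.+1 -> R.

Let ups : uniq (p :: s).
Proof. by rewrite /= us andbT; apply: contraL pW => /sW. Qed.
Let usq : uniq (rcons s q).
Proof. by rewrite rcons_uniq us andbT; apply: contraL qW => /sW. Qed.
Local Notation zs := (zip (p :: s) (rcons s q)).
Local Notation B := (ear_mx A p q s b).

Let outA i j : (i \in s) || (j \in s) -> A i j = 0.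
Proof.
by case/orP => /sW h; rewrite (cert_out CA) // h ?orbT.
Qed.

Lemma ear_mx_in w i j : i \notin s -> j \notin s -> B w i j = A i j.
Proof.
move=> /negbTE is_ /negbTE js; rewrite mxE is_ andbF addr0.
case: ifP => [/(mem_ear_zip s0 ups usq)[_ _]|]; last by rewrite addr0.
by rewrite is_ js.
Qed.

Lemma ear_mx_diag w m : m \in s -> B w m m = b m.
Proof.
move=> ms; rewrite mxE outA ?ms // eqxx add0r.
by case: ifP => [/(mem_ear_zip s0 ups usq)[_ _ _]|]; rewrite ?eqxx // addr0.
Qed.

Lemma ear_mx_ear w i j : (j, i) \in zs -> B w i j = if j == last p s then w else 1.
Proof.
move=> ji; have [h1 h2 h3 h4] := mem_ear_zip s0 ups usq ji.
by rewrite mxE outA 1?orbC // (negbTE h4) ji !add0r.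
Qed.

Lemma ear_mx_normr_le w i j : 0 <= w <= 1 -> `|B w i j| <= `|B 1 i j|.
Proof.
move=> /andP[w_ge0 w_le1].
have [ji|ji] := boolP ((j, i) \in zs).
  rewrite !ear_mx_ear //; case: eqP => // _.
  by rewrite normr1 ger0_norm.
by rewrite !mxE (negbTE ji).
Qed.

Lemma ear_mx_normr_ge w i j : `|A i j| <= `|B w i j|.
Proof.
have [h|] := boolP ((i \in s) || (j \in s)); first by rewrite outA // normr0.
by rewrite negb_or => /andP[h1 h2]; rewrite ear_mx_in.
Qed.

(* [ear_response] with adjugates instead of inverses: polynomial in [w]. *)
Let adj_response (w : R) (e : 'I_n.+1 * 'I_n.+1) (x : R) : R :=
  let beta := \prod_(m <- s) (x - b m) in
  let H := x%:M - ear_eff A p q s b w x in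
  if e \in T then \adj H ord0 e.2 * \adj H e.1 ord0
  else \adj H ord0 q * \adj H p ord0 / (beta * if e.1 == e.2 then x - b e.1 else 1).

Let ear_eff_continuous i j x :
  {for 0, continuous (fun w : R => (x%:M - ear_eff A p q s b w x) i j)}.
Proof.
have CR := fun_subring_continuous R (0 : R).
pose f (w : R) := (x%:M - A) i j - (\prod_(m <- s) (x - b m))^-1 * (delta_mx q p i j : R) * w.
apply: (@fsr_ext R R (fun f => {for 0, continuous f}) f) => [w|]; first by rewrite /f !mxE; ring.
apply: (fsr_add CR); first exact: (fsr_cst CR).
apply: (fsr_opp CR); apply: (fsr_mul CR); first exact: (fsr_cst CR).
exact: cvg_id.
Qed.

Let adj_response_continuous e x : {for 0, continuous (fun w : R => adj_response w e x)}.
Proof.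
have CR := fun_subring_continuous R (0 : R).
rewrite /adj_response; cbv zeta; case: (e \in T).
  by apply: (fsr_mul CR); apply: (fsr_adj CR) => i j; exact: ear_eff_continuous.
apply: (fsr_mul CR); last exact: (fsr_cst CR).
by apply: (fsr_mul CR); apply: (fsr_adj CR) => i j; exact: ear_eff_continuous.
Qed.

Let adj_responseE w e x : x%:M - ear_eff A p q s b w x \in unitmx ->
  adj_response w e x = \det (x%:M - ear_eff A p q s b w x) ^+ 2 * ear_response A T p q s b w e x.
Proof.
move=> u; rewrite /adj_response /ear_response adj_invmx //.
by case: ifP => _; rewrite !mxE; ring.
Qed.

Hypothesis b_inj : {in s &, injective b}.
Hypothesis bA : forall m, m \in s -> dominates A (b m).

Let TW : {in T, forall e, (e.1 \in W) && (e.2 \in W)}.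
Proof.
move=> e /(cert_basis CA)/orP[|/andP[/eqP <- ->]//].
by case: WE => _ + _ => /[apply] -[-> ->].
Qed.

(** The induction step: for w > 0 small enough, adding an ear of last weight [w]
    preserves the certificate. *)
Lemma ear_certificate :
  exists w, certificate (W :|: [set:: s])%SET (E :|: ear_edges p s q)%SET
    (B w) (ear_basis T p q s).
Proof.
have [oW EW _] := WE.
have [x1 x1_gt0 domB] := dominates_ltr (B 1).
have domA w x : 0 <= w <= 1 -> x1 < x -> dominates A x /\ dominates (B w) x.
  move=> w01 /domB d1; have d2 : dominates (B w) x.
    by apply: dominates_le d1 => i j; exact: ear_mx_normr_le.
  by split=> //; apply: dominates_le d2 => i j; exact: ear_mx_normr_ge.
have bx m x : m \in s -> x1 < x -> b m < x.
  by move=> ms /domB d1; rewrite -(ear_mx_diag 1 ms); exact: dominates_diag.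
have uA := certificate_unitmx CA.
have ind0 : indep_on (fun x => x1 < x) (ear_basis T p q s) (ear_response A T p q s b 0).
  apply: (@indep_ear0 R n A T W p q s b x1) => //; first exact: (cert_indep CA).
    by move=> x x1x; have [] := domA 1 x _ x1x; rewrite ?ler01 ?lexx.
  move=> m /bA d; have u := uA _ d.
  rewrite !adj_invmx // !mxE !mulf_eq0 !negb_or.
  move: (u); rewrite unitmxE unitfE => -> /=.
  by rewrite !gt_eqF //; apply: (certificate_resolvent_gt0 WE CA d).
have [xs xsP] := indep_on_finite ind0.
have u0 x : x \in xs -> x%:M - ear_eff A p q s b 0 x \in unitmx.
  move=> /xsP x1x; rewrite /ear_eff mul0r scale0r addr0.
  by apply: uA; have [] := domA 1 x _ x1x; rewrite ?ler01 ?lexx.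
move=> indxs.
have indadj : indep_on (fun x => x \in xs) (ear_basis T p q s) (adj_response 0).
  move=> c cF; apply: indxs => x xxs; have := cF x xxs.
  rewrite (eq_bigr (fun e => \det (x%:M - ear_eff A p q s b 0 x) ^+ 2 *
    (c e * ear_response A T p q s b 0 e x))); last first.
    by move=> e _; rewrite adj_responseE ?u0 //; ring.
  rewrite -mulr_sumr => /eqP; rewrite mulf_eq0 expf_eq0 /=.
  by have := u0 x xxs; rewrite unitmxE unitfE => /negbTE -> /= /eqP.
have CR := fun_subring_continuous R (0 : R).
have near1 := indep_on_near (fun e x _ _ => @adj_response_continuous e x) indadj.
have near2 : \forall w \near (0 : R),
    \prod_(x <- xs) \det (x%:M - ear_eff A p q s b w x) != 0.
  apply: near_neq0.
    by apply: (fsr_prod CR) => x _; apply: (fsr_det CR) => i j; exact: ear_eff_continuous.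
  rewrite prodf_seq_neq0; apply/allP => x /u0.
  by rewrite unitmxE unitfE.
have [w [w0 w1 [indw detw]]] : exists w, [/\ 0 < w, w <= 1 &
    indep_on (fun x => x \in xs) (ear_basis T p q s) (adj_response w) /\
    \prod_(x <- xs) \det (x%:M - ear_eff A p q s b w x) != 0].
  have [e /= e0 ePw] := filterI near1 near2.
  exists (Num.min 1 (e / 2)); split.
  - by rewrite lt_min ltr01 divr_gt0.
  - by rewrite ge_min lexx.
  apply: ePw => /=; rewrite sub0r normrN ger0_norm.
    by rewrite gt_min [X in _ || X]ltr_pdivrMr // ltr_pMr // ltr1n orbT.
  by rewrite le_min ler01 divr_ge0 // ltW.
exists w; split.
- move=> i j; rewrite !inE => /orP[jiE|ji].
    have [/= jW iW _] := EW _ jiE.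
    rewrite ear_mx_in ?(cert_edge CA) //.
      by apply: contraL iW => /sW.
    by apply: contraL jW => /sW.
  by rewrite ear_mx_ear //; case: ifP.
- move=> i j ij; rewrite !inE negb_or => /andP[jiE ji].
  by rewrite mxE (cert_nonedge CA ij jiE) (negbTE ij) (negbTE ji) !addr0.
- move=> i j; rewrite !inE !negb_or => h.
  have ij : (i \notin s) && (i \notin W) || (j \notin s) && (j \notin W).
    by move: h; rewrite ![(_ \notin W) && _]andbC.
  rewrite mxE (cert_out CA) ?add0r; last first.
    by case/orP: h => /andP[-> _]; rewrite ?orbT.
  case: ifP => [/andP[/eqP ij' is_]|_].
    by move: h; rewrite -ij' is_ !andbF.
  rewrite add0r; case: ifP => // /(mem_ear_zip s0 ups usq)[].
  rewrite mem_rcons !inE => h1 h2 _ _; exfalso; move: h1 h2 h.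
  by case/orP => [/eqP ->|->]; case/orP => [/eqP ->|->]; rewrite ?pW ?qW ?andbF.
- move=> e; rewrite !inE => /or3P[eT|/imsetP[m ms ->]|/eqP ->] /=.
  + have /orP[->//|/andP[-> ->]] := cert_basis CA eT.
    by rewrite !orbT.
  + by rewrite eqxx ms !orbT.
  + by rewrite mem_ear_last // orbT.
- rewrite (card_ear_basis p qW s0 us sW TW).
  apply: leq_ltn_trans (leq_card_setU _ _) _.
  rewrite -addSn; apply: leq_add (cert_card CA) _.
  rewrite /ear_edges cardsE; apply: leq_trans (card_size _) _.
  by rewrite size1_zip ?size_rcons.
move=> c cF.
(* The factor by which the true functions differ from [ear_response]. *)
pose wt e := if (e \notin T) && (e.1 == e.2) then w else 1.
have wt0 e : wt e != 0 by rewrite /wt; case: ifP => _; rewrite ?oner_neq0 ?gt_eqF.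
move=> e eT; apply/eqP; rewrite -(mulIr_eq0 _ (mulIf (wt0 e))); apply/eqP.
apply: (indw (fun e => c e * wt e)) => // x xxs {e eT}.
have x1x := xsP _ xxs; have [dA dB] := domA w x ltac:(by rewrite ltW) x1x.
have u2 : x%:M - ear_eff A p q s b w x \in unitmx.
  move: detw; rewrite prodf_seq_neq0 => /allP/(_ x xxs) /=.
  by rewrite unitmxE unitfE.
rewrite -[RHS](mulr0 (\det (x%:M - ear_eff A p q s b w x) ^+ 2)) -[in RHS](cF x dB) mulr_sumr.
apply: eq_bigr => e eT; rewrite adj_responseE //.
suff -> : edge_response (B w) e x = wt e * ear_response A T p q s b w e x by ring.
have u1 : x%:M - B w \in unitmx.
  apply: metzler_unitmx => // i j ij.
  have [ji|/negbTE ji] := boolP ((j, i) \in zs).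
    by rewrite ear_mx_ear //; case: ifP => // _; exact: ltW.
  by rewrite mxE ji (negbTE ij) !addr0 (certificate_ge0 CA).
have xb : {in s, forall m, x != b m}.
  by move=> m ms; rewrite gt_eqF // bx.
have cO := cert_out CA.
rewrite /wt /ear_response /edge_response /resolvent.
case: (boolP (e \in T)) => eT' /=.
  have /andP[e1 e2] := TW eT'.
  rewrite mul1r (ear_resolvent_row oW pW qW s0 us sW cO xb u1 u2 e2).
  by rewrite (ear_resolvent_col oW pW qW us sW cO xb u1 u2 e1).
move: eT; rewrite !inE (negbTE eT') /= => /orP[/imsetP[m ms ->]|/eqP ->] /=.
  by rewrite eqxx (ear_resolvent_loop oW pW qW s0 us sW cO xb u1 u2 ms).
rewrite (ear_resolvent_last oW pW qW s0 us sW cO xb u1 u2).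
have : last p s \in s by case: (s) s0 => //= a l _; rewrite mem_last.
by case: eqP => [->|_ _]; [move=> /sW; rewrite qW | rewrite mul1r mulr1].
Qed.
End EarStep.

Lemma ear_graph_certificate (R : realType) (n : nat) (W : {set 'I_n.+1})
    (E : {set 'I_n.+1 * 'I_n.+1}) :
  ear_graph W E -> wired W E /\ exists A T, @certificate R n W E A T.
Proof.
move: W E; apply: ear_graph_closed_ind.
  by split; [exact: wired0 | exists 0, [set (ord0, ord0)]%SET; exact: certificate0].
move=> W E p q s [WE [A [T CA]]] pW qW s0 us sW; split; first exact: wired_ear.
have [x0 _ dom] := dominates_ltr A.
pose b (m : 'I_n.+1) := x0 + 1 + m%:R.
have [|m ms|w Cw] := ear_certificate WE CA pW qW s0 us sW (b := b).
- by move=> i j _ _ /addrI /eqP; rewrite eqr_nat => /eqP /val_inj.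
- by apply: dom; rewrite /b -addrA ltrDl ltr_pwDl // ler0n.
by exists (ear_mx A p q s b w), (ear_basis T p q s).
Qed.

(** * Null sets *)

Lemma lebesgue_null_subset (R : realType) (m : nat) (N N' : set 'rV[R]_m) :
  N `<=` N' -> lebesgue_null N' -> lebesgue_null N.
Proof.
move=> NN' null e /null[a [b [ab N'ab sum_e]]]; exists a, b; split=> //.
exact: subset_trans N'ab.
Qed.

(** The boxes of the k-th set are chosen with total volume e / 2^(k+1). *)
Lemma lebesgue_null_bigcup (R : realType) (m : nat) (N : nat -> set 'rV[R]_m) :
  (forall k, lebesgue_null (N k)) -> lebesgue_null (\bigcup_k N k).
Proof.
move=> Nnull e e_gt0.
have /choice[a] : forall k, exists a : nat -> 'rV[R]_m, exists b : nat -> 'rV[R]_m,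
    [/\ forall l i, a l 0 i <= b l 0 i,
        N k `<=` \bigcup_l [set x : 'rV[R]_m | forall i, a l 0 i <= x 0 i <= b l 0 i]
      & (\sum_(0 <= l <oo) (\prod_i (b l 0 i - a l 0 i))%:E <= (e / (2 ^ k.+1)%:R)%:E)%E].
  by move=> k; apply: (Nnull k); rewrite divr_gt0 // ltr0n expn_gt0.
move=> /choice[b abP].
have /ppcard_eqP[f] := card_esym card_nat2.
pose v (kl : nat * nat) : \bar R := (\prod_i (b kl.1 kl.2 0 i - a kl.1 kl.2 0 i))%:E.
have v_ge0 kl : (0 <= v kl)%E.
  by rewrite lee_fin prodr_ge0 // => i _; rewrite subr_ge0; case: (abP kl.1) => /(_ kl.2 i).
exists (fun j => a (f j).1 (f j).2), (fun j => b (f j).1 (f j).2); split.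
- by move=> j i; case: (abP (f j).1) => /(_ (f j).2 i).
- move=> x [k _ Nx]; have [_ + _] := abP k => /(_ x Nx)[l _ xl].
  by exists (f^-1%FUN (k, l)) => //=; rewrite invK ?inE.
rewrite -[leLHS]/(\sum_(j <oo) v (f j))%E nneseries_esumT //.
rewrite -(@reindex_esum R nat (nat * nat)%type setT setT f v); last exact: bij.
have -> : [set: nat * nat] = setT `*`` (fun=> setT) by apply/seteqP; split.
rewrite -(@esum_esum R nat nat setT (fun=> setT) (fun k l => v (k, l))) //.
rewrite -nneseries_esumT; last by move=> k; apply: esum_ge0.
apply: le_trans (epsilon_trick0 xpredT (ltW e_gt0)).
apply: lee_nneseries => k *; first exact: esum_ge0.
rewrite -nneseries_esumT //.
by have [_ _] := abP k.
Qed.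

(** A finite cover is completed by boxes reduced to a point, which have volume 0
    because the dimension is positive. *)
Lemma lebesgue_null_finite_cover (R : realType) (m : nat) (N : set 'rV[R]_m.+1) :
  (forall e : R, 0 < e -> exists (J : finType) (a b : J -> 'rV[R]_m.+1),
     [/\ forall j i, a j 0 i <= b j 0 i,
         N `<=` \bigcup_j [set x : 'rV[R]_m.+1 | forall i, a j 0 i <= x 0 i <= b j 0 i]
       & \sum_j \prod_i (b j 0 i - a j 0 i) <= e]) ->
  lebesgue_null N.
Proof.
move=> Ncov e /Ncov[J [a [b [ab Nab sum_e]]]].
pose pad (u : J -> 'rV[R]_m.+1) k :=
  if (insub k : option 'I_#|J|) is Some l then u (@enum_val J (mem J) l) else 0.
have padE u (l : 'I_#|J|) : pad u l = u (enum_val l) by rewrite /pad valK.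
have pad0 u k : (#|J| <= k)%N -> pad u k = 0.
  by move=> Jk; rewrite /pad insubF // ltnNge Jk.
have vol_ge0 k : (0 <= (\prod_i (pad b k 0 i - pad a k 0 i))%:E)%E.
  rewrite lee_fin prodr_ge0 // => i _; rewrite subr_ge0.
  have [kJ|Jk] := ltnP k #|J|; last by rewrite !pad0.
  by rewrite -[k]/(val (Ordinal kJ)) !padE.
exists (pad a), (pad b); split.
- move=> k i; have [kJ|Jk] := ltnP k #|J|; last by rewrite !pad0.
  by rewrite -[k]/(val (Ordinal kJ)) !padE.
- move=> x /Nab[j _ xj]; exists (enum_rank j) => // i /=.
  by rewrite !padE enum_rankK.
rewrite (nneseries_split 0%N #|J|) // add0n [X in (_ + X)%E]eseries0 ?adde0; last first.
  by move=> k Jk _; rewrite !pad0 // big_ord_recl /= subrr mul0r.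
rewrite sumEFin lee_fin big_mkord; apply: le_trans sum_e.
rewrite [leRHS](reindex _ (onW_bij _ (enum_val_bij J))) /=.
by under eq_bigr do rewrite !padE.
Qed.

Lemma lebesgue_null0 (R : realType) (m : nat) : lebesgue_null (set0 : set 'rV[R]_m.+1).
Proof.
apply: lebesgue_null_finite_cover => e e_gt0.
exists 'I_0, (fun=> 0), (fun=> 0); split=> //.
by rewrite big_ord0 ltW.
Qed.

Lemma lebesgue_null_countable (R : realType) (m : nat) (J : countType)
    (N : J -> set 'rV[R]_m.+1) :
  (forall j, lebesgue_null (N j)) -> lebesgue_null (\bigcup_j N j).
Proof.
move=> Nnull.
apply: (@lebesgue_null_subset _ _ _ (\bigcup_k if unpickle k is Some j then N j else set0)).
  by move=> x [j _ Njx]; exists (pickle j) => //; rewrite pickleK.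
by apply: lebesgue_null_bigcup => k; case: unpickle => [j|]; [exact: Nnull | exact: lebesgue_null0].
Qed.

(** A bounded set on which the i-th coordinate is a Lipschitz function of the
    others is null. Cut the cube [-L, L]^m of the other coordinates into cells of
    side h: above each cell the set lies in a box of height 2 K h, so that the
    total volume is O(h). *)
Lemma lebesgue_null_graph (R : realType) (m : nat) (N : set 'rV[R]_m.+1)
    (i : 'I_m.+1) (L K : R) :
  0 < L -> 0 <= K -> (forall x j, N x -> `|x 0 j| <= L) ->
  (forall x y (r : R), 0 <= r -> N x -> N y -> (forall j, j != i -> `|x 0 j - y 0 j| <= r) ->
     `|x 0 i - y 0 i| <= K * r) ->
  lebesgue_null N.
Proof.
move=> L_gt0 K_ge0 NL NK; apply: lebesgue_null_finite_cover => e e_gt0.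
pose C := (4 * L) ^+ m * (4 * K * L).
(* k + 1 cells in each direction, since the point L lies in the cell of index k. *)
pose k := (Num.truncn (C / e)).+1; pose h := 2 * L / k%:R.
have k_gt0 : 0 < k%:R :> R by rewrite ltr0n.
have h_gt0 : 0 < h by rewrite divr_gt0 // mulr_gt0.
have hk : h * k%:R = 2 * L by rewrite /h divfK // gt_eqF.
have Cke : C / k%:R <= e.
  rewrite ler_pdivrMr // mulrC -ler_pdivrMr //.
  by apply: ltW; rewrite /k; exact: truncnS_gt.
pose cell (g : {ffun 'I_m -> 'I_k.+1}) := N `&`
  [set x : 'rV[R]_m.+1 | forall j, - L + (g j)%:R * h <= x 0 (lift i j) <= - L + (g j).+1%:R * h].
have /choice[y yP] : forall g, exists y, cell g !=set0 -> cell g y.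
  by move=> g; have [[y gy]|n0] := pselect (cell g !=set0); [exists y | exists 0].
pose a (g : {ffun 'I_m -> 'I_k.+1}) := \row_j
  (if unlift i j is Some j' then - L + (g j')%:R * h else y g 0 i - K * h).
pose b (g : {ffun 'I_m -> 'I_k.+1}) := \row_j
  (if unlift i j is Some j' then - L + (g j').+1%:R * h else y g 0 i + K * h).
exists {ffun 'I_m -> 'I_k.+1}, a, b; split.
- move=> g j; rewrite !mxE; case: unliftP => [j'|] _.
    by rewrite lerD2l ler_pM2r // ler_nat.
  by rewrite lerD2l ge0_cp // mulr_ge0 // ltW.
- move=> x Nx.
  have xge j : 0 <= (x 0 j + L) / h.
    rewrite divr_ge0 ?(ltW h_gt0) // -lerBlDr sub0r.
    by have := NL x j Nx; rewrite ler_norml => /andP[].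
  have xlt j : (Num.truncn ((x 0 j + L) / h)%R < k.+1)%N.
    rewrite ltnS -(ler_nat R); apply: le_trans (_ : (x 0 j + L) / h <= _).
      by rewrite truncn_le.
    rewrite ler_pdivrMr // mulrC hk.
    by have := NL x j Nx; rewrite ler_norml => /andP[_]; lra.
  pose g := [ffun j => Ordinal (xlt (lift i j))].
  have gx : cell g x.
    split=> // j; rewrite ffunE /=.
    have /andP[h1 h2] := truncn_itv (xge (lift i j)).
    rewrite ler_pdivlMr // in h1; rewrite ltr_pdivrMr // in h2.
    by apply/andP; split; [lra | apply: ltW; lra].
  exists g => // j; rewrite !mxE; have [Ny gy] := yP g (ex_intro _ x gx).
  case: unliftP => [j' ->|->]; first exact: gx.2.
  have := NK x (y g) h (ltW h_gt0) Nx Ny; rewrite ler_norml => H.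
  suff /H/andP[] : forall j, j != i -> `|x 0 j - y g 0 j| <= h by lra.
  move=> l; case: (unliftP i l) => [l' -> _|->]; last by rewrite eqxx.
  have /andP[u1 u2] := gx.2 l'; have /andP[v1 v2] := gy l'.
  rewrite ler_norml; move: u1 u2 v1 v2; rewrite -natr1 mulrDl mul1r; lra.
rewrite (eq_bigr (fun=> 2 * K * h * h ^+ m)).
  rewrite sumr_const card_ffun !card_ord -[_ *+ _]mulr_natr natrX -mulrA -exprMn.
  apply: le_trans Cke; rewrite /C mulrC.
  have -> : (4 * L) ^+ m * (4 * K * L) / k%:R = (4 * L) ^+ m * (2 * K * h).
    by rewrite /h; field; rewrite gt_eqF.
  have Kh : 0 <= 2 * K * h by rewrite !mulr_ge0 // ltW.
  have hL : h <= 2 * L.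
    by rewrite /h ler_pdivrMr // ler_peMr ?ler1n // mulr_ge0 // ltW.
  have hk1 : h * k.+1%:R <= 4 * L by rewrite -natr1 mulrDr hk mulr1; lra.
  apply: ler_wpM2r => //; rewrite lerXn2r ?nnegrE //.
    by rewrite mulr_ge0 // ltW.
  by rewrite mulr_ge0 // ltW.
move=> g _; rewrite (bigD1_ord i) //= !mxE unlift_none; congr (_ * _); first by lra.
rewrite -[in RHS](card_ord m) -prodr_const; apply: eq_bigr => j _.
by rewrite !mxE liftK -natr1; lra.
Qed.

(** * Zero sets of polynomials *)

(** The polynomial function on row vectors defined by [p]. *)
Definition mpoly_fun (R : realType) (m : nat) (p : mpoly m R) (x : 'rV[R]_m) : R :=
  meval (fun i => x 0 i) p.

Lemma mpoly_closed_ind (R : comNzRingType) (m : nat) (P : mpoly m R -> Prop) :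
  (forall c, P (mpolyC m c)) -> (forall i, P (mpolyX R (mnm1 i))) ->
  (forall p q, P p -> P q -> P (p + q)) -> (forall p q, P p -> P q -> P (p * q)) ->
  forall p, P p.
Proof.
move=> PC PX PD PM; apply: mpolyind => [|c u p _ _ Pp].
  by rewrite -mpolyC0; exact: PC.
apply: (PD) => //; rewrite -mul_mpolyC; apply: (PM) => //; rewrite mpolyXE_id.
elim/big_ind: _ => [|v w Pv Pw|i _]; [by rewrite -mpolyC1; exact: PC|exact: PM|].
elim: (u i) => [|k IH]; first by rewrite expr0 -mpolyC1; exact: PC.
by rewrite exprS; exact: PM.
Qed.

Lemma fsr_meval (R : comNzRingType) (X : Type) (C : (X -> R) -> Prop) (m : nat)
    (g : 'I_m -> X -> R) (p : mpoly m R) :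
  fun_subring C -> (forall i, C (g i)) -> C (fun x => meval (fun i => g i x) p).
Proof.
move=> CR Cg; move: p; apply: mpoly_closed_ind => [c|i|p q Cp Cq|p q Cp Cq].
- by apply: fsr_ext (fsr_cst CR c) => x; rewrite mevalC.
- by apply: fsr_ext (Cg i) => x; rewrite mevalXU.
- by apply: fsr_ext (fsr_add CR Cp Cq) => x; rewrite mevalD.
- by apply: fsr_ext (fsr_mul CR Cp Cq) => x; rewrite mevalM.
Qed.

(** Continuous divided differences [M j] of [p]: p(x) - p(y) is the sum of the
    M_j(x, y) (x_j - y_j), and M_j is the j-th partial derivative on the
    diagonal. *)
Definition slope (R : realType) (m : nat) (p : mpoly m R)
    (M : 'I_m -> 'rV[R]_m * 'rV[R]_m -> R) : Prop :=
  [/\ forall j, continuous (M j),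
      forall x y, mpoly_fun p x - mpoly_fun p y = \sum_j M j (x, y) * (x 0 j - y 0 j)
    & forall j x, M j (x, x) = mpoly_fun (mderiv j p) x].

Lemma exists_slope (R : realType) (m : nat) (p : mpoly m R) : exists M, slope p M.
Proof.
have CR (z : 'rV[R]_m * 'rV[R]_m) := fun_subring_continuous R z.
move: p; apply: mpoly_closed_ind => [c|i|p q [M [Mc MD Md]] [N [Nc ND Nd]]|
    p q [M [Mc MD Md]] [N [Nc ND Nd]]].
- exists (fun _ _ => 0); split=> [j z|x y|j x]; first exact: (fsr_cst (CR z)).
    by rewrite /mpoly_fun !mevalC subrr big1 // => j _; rewrite mul0r.
  by rewrite /mpoly_fun mderivC meval0.
- exists (fun j _ => (i == j)%:R); split=> [j z|x y|j x]; first exact: (fsr_cst (CR z)).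
    rewrite /mpoly_fun !mevalXU (bigD1 i) //= eqxx mul1r big1 ?addr0 // => j.
    by rewrite eq_sym => /negbTE ->; rewrite mul0r.
  rewrite /mpoly_fun mderivX mevalZ mnm1E.
  have [->|_] := eqVneq i j; last by rewrite mul0r.
  have -> : mnm_sub (mnm1 j) (mnm1 j) = mnm0 by apply/mnmP => k; rewrite !mnmE subnn.
  by rewrite mul1r mpolyX0 meval1.
- exists (fun j z => M j z + N j z); split=> [j z|x y|j x].
  + by apply: (fsr_add (CR z)); [exact: Mc | exact: Nc].
  + rewrite /mpoly_fun !mevalD opprD addrACA -!/(mpoly_fun _ _) MD ND -big_split.
    by apply: eq_bigr => j _; rewrite mulrDl.
  + by rewrite /mpoly_fun mderivD mevalD -!/(mpoly_fun _ _) Md Nd.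
have pc z : {for z, continuous (fun z : 'rV[R]_m * 'rV[R]_m => mpoly_fun p z.1)}.
  apply: (fsr_meval p (CR z)) => i.
  apply: (@continuous_comp _ _ _ fst (fun x : 'rV[R]_m => x 0 i)); first exact: cvg_fst.
  exact: coord_continuous.
have qc z : {for z, continuous (fun z : 'rV[R]_m * 'rV[R]_m => mpoly_fun q z.2)}.
  apply: (fsr_meval q (CR z)) => i.
  apply: (@continuous_comp _ _ _ snd (fun x : 'rV[R]_m => x 0 i)); first exact: cvg_snd.
  exact: coord_continuous.
exists (fun j z => M j z * mpoly_fun q z.2 + mpoly_fun p z.1 * N j z); split=> [j z|x y|j x].
- apply: (fsr_add (CR z)); apply: (fsr_mul (CR z)).
  + exact: Mc.
  + exact: qc.
  + exact: pc.
  + exact: Nc.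
- rewrite /mpoly_fun !mevalM -!/(mpoly_fun _ _) /=.
  have -> : mpoly_fun p x * mpoly_fun q x - mpoly_fun p y * mpoly_fun q y =
    (mpoly_fun p x - mpoly_fun p y) * mpoly_fun q y +
    mpoly_fun p x * (mpoly_fun q x - mpoly_fun q y) by ring.
  rewrite MD ND mulr_suml mulr_sumr -big_split; apply: eq_bigr => j _ /=; ring.
- by rewrite /mpoly_fun mderivM mevalD !mevalM -!/(mpoly_fun _ _) Md Nd.
Qed.

Lemma ltn_msize_mderiv (R : numDomainType) (m : nat) (p : mpoly m R) (i : 'I_m) d :
  (msize p <= d.+1)%N -> (msize (mderiv i p) <= d)%N.
Proof.
move=> pd; rewrite msizeE big_seq; elim/big_ind: _ => // [u v|u].
  by rewrite geq_max => -> ->.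
rewrite mcoeff_msupp mcoeff_deriv => up.
have : mnm_add u (mnm1 i) \in msupp p.
  by rewrite mcoeff_msupp; apply: contraNneq up => ->; rewrite mul0rn.
by move=> /msize_mdeg_lt; rewrite mdegD mdeg1 addn1 => /leq_trans/(_ pd).
Qed.

Lemma mderiv_neq0 (R : numDomainType) (m : nat) (p : mpoly m R) :
  (1 < msize p)%N -> exists i, mderiv i p != 0.
Proof.
move=> p1; have [u up u0] : exists2 u, u \in msupp p & (0 < mdeg u)%N.
  apply: contrapT => /forall2NP h; move: p1; rewrite ltnNge => /negP; apply.
  rewrite msizeE big_seq; elim/big_ind: _ => // [k l|u up].
    by rewrite geq_max => -> ->.
  by have [//|] := h u; move=> /negP; rewrite -leqNgt.
have [i ui] : exists i, u i != 0%N.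
  apply: contrapT => /forallNP h; move: u0; rewrite lt0n mdeg_eq0 => /eqP; apply.
  by apply/mnmP => i; rewrite mnm0E; apply/eqP/negP => /negP/h.
exists i; apply: contraTneq up => pi0.
have := mcoeff_deriv i (mnm_sub u (mnm1 i)) p.
rewrite pi0 mcoeff0 submK; last by rewrite lep1mP.
move=> /esym/eqP; rewrite mulrn_eq0 /= => /eqP pu.
by rewrite mcoeff_msupp pu eqxx.
Qed.

(** A locally null set is null, by means of the countably many cubes with
    rational centre and half-side 1 / (k + 1). *)
Lemma lebesgue_null_local (R : realType) (m : nat) (N : set 'rV[R]_m.+1) :
  (forall x, N x -> exists2 d : R, 0 < d &
     lebesgue_null (N `&` [set y | forall j, `|y 0 j - x 0 j| < d])) ->
  lebesgue_null N.
Proof.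
move=> Nloc.
pose box (ak : 'rV[rat]_m.+1 * nat) :=
  [set y : 'rV[R]_m.+1 | forall j, `|y 0 j - ratr (ak.1 0 j)| < ak.2.+1%:R^-1].
pose B ak := if `[< lebesgue_null (N `&` box ak) >] then N `&` box ak else set0.
apply: (@lebesgue_null_subset _ _ _ (\bigcup_ak B ak)); last first.
  apply: lebesgue_null_countable => ak; rewrite /B; case: asboolP => // _.
  exact: lebesgue_null0.
move=> x Nx; have [d d_gt0 dnull] := Nloc x Nx.
pose k := Num.truncn (2 / d).
have kd : 2 / k.+1%:R < d.
  by rewrite ltr_pdivrMr ?ltr0n // mulrC -ltr_pdivrMr // truncnS_gt.
have k_gt0 : 0 < k.+1%:R^-1 :> R by rewrite invr_gt0 ltr0n.
have /choice[a aP] : forall j, exists r : rat, `|x 0 j - ratr r| < k.+1%:R^-1.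
  move=> j; have [|r] := @rat_in_itvoo R (x 0 j - k.+1%:R^-1) (x 0 j + k.+1%:R^-1).
    by move: k_gt0; move: (k.+1%:R^-1 : R) => u u_gt0; lra.
  rewrite in_itv /= => /andP[r1 r2]; exists r; rewrite ltr_norml.
  by move: r1 r2; move: (k.+1%:R^-1 : R) => u r1 r2; apply/andP; split; lra.
have xbox : box (\row_j a j, k) x by move=> j; rewrite mxE.
exists (\row_j a j, k) => //; rewrite /B asboolT; first by [].
apply: lebesgue_null_subset dnull => y [Ny ybox]; split=> // j /=.
apply: lt_trans kd.
rewrite -(subrKA (ratr (a j))); apply: le_lt_trans (ler_normD _ _) _.
have := ybox j; rewrite mxE /= => h1; have h2 := aP j.
rewrite distrC in h2.
have -> : 2 / k.+1%:R = k.+1%:R^-1 + k.+1%:R^-1 :> R by rewrite mulrDl mul1r.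
exact: ltrD.
Qed.

(** Near a zero of [p] where the i-th partial derivative does not vanish, the
    divided differences bound the variation of the i-th coordinate along the zero
    set by that of the other coordinates. *)
Lemma lebesgue_null_regular_zeros (R : realType) (m : nat) (p : mpoly m.+1 R) i :
  lebesgue_null [set x | mpoly_fun p x = 0 /\ mpoly_fun (mderiv i p) x != 0].
Proof.
have [M [Mc MD Md]] := exists_slope p.
apply: lebesgue_null_local => x [px dpx].
pose S z : R := \sum_j `|M j z|.
have CR (z : 'rV[R]_m.+1 * 'rV[R]_m.+1) := fun_subring_continuous R z.
have normc j z : {for z, continuous (fun z => `|M j z|)}.
  by apply: (@continuous_comp _ _ _ (M j) (fun r : R => `|r|)); [exact: Mc | exact: norm_continuous].
have Sc : {for (x, x), continuous S}.
  by apply: (fsr_sum (CR (x, x))) => j _; exact: normc.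
pose c := `|M i (x, x)| / 2; pose C := S (x, x) + 1.
have c_gt0 : 0 < c by rewrite divr_gt0 // normr_gt0 Md.
have near1 : \forall z \near (x, x), S z < C.
  by have := @cvgr_lt _ _ _ _ S _ Sc C; apply; rewrite ltrDl ltr01.
have near2 : \forall z \near (x, x), c < `|M i z|.
  have := @cvgr_gt _ _ _ _ _ _ (normc i (x, x)) c; apply.
  by move: c_gt0; rewrite /c; lra.
have : nbhs_ball ((x, x) : 'rV[R]_m.+1 * 'rV[R]_m.+1) [set z | S z < C /\ c < `|M i z|].
  by rewrite nbhs_ballE; exact: filterI near1 near2.
move=> [d /= d_gt0 dP].
exists d => //.
apply: (@lebesgue_null_graph _ _ _ i (\sum_j `|x 0 j| + d) (C / c)).
- by rewrite ltr_wpDl // sumr_ge0.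
- by rewrite divr_ge0 ?(ltW c_gt0) // addr_ge0 ?ler01 // sumr_ge0.
- move=> y j [_ /(_ j) yd].
  rewrite -[y 0 j](subrK (x 0 j)) (le_trans (ler_normD _ _)) // addrC lerD ?(ltW yd) //.
  by rewrite (bigD1 j) //= lerDl sumr_ge0.
move=> y z r r_ge0 [[/= py _] yd] [[/= pz _] zd] yz.
have [] : S (y, z) < C /\ c < `|M i (y, z)|.
  apply: dP; split=> /=; split=> // i0 j; rewrite [i0]ord1 /ball /= distrC; [exact: yd | exact: zd].
move=> SC Mc'.
have := MD y z; rewrite py pz subrr (bigD1 i) //= => /esym/eqP.
rewrite addr_eq0 => /eqP E.
have : `|M i (y, z)| * `|y 0 i - z 0 i| <= S (y, z) * r.
  rewrite -normrM E normrN; apply: le_trans (ler_norm_sum _ _ _) _.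
  rewrite /S mulr_suml [leRHS](bigD1 i) //= ler_wpDl ?mulr_ge0 //.
  by apply: ler_sum => j ji; rewrite normrM ler_wpM2l // yz.
move=> H; rewrite mulrAC ler_pdivlMr // mulrC.
apply: le_trans (_ : `|M i (y, z)| * `|y 0 i - z 0 i| <= _).
  by rewrite ler_wpM2r // ltW.
by apply: le_trans H _; rewrite ler_wpM2r // ltW.
Qed.

Lemma lebesgue_null_zeros (R : realType) (m : nat) (p : mpoly m.+1 R) :
  p != 0 -> lebesgue_null [set x | mpoly_fun p x = 0].
Proof.
elim: {p}(msize p) {-2}p (leqnn (msize p)) => [|d IH] p pd p0.
  by move: pd; rewrite leqn0 msize_poly_eq0 (negbTE p0).
have [p1|p1] := leqP (msize p) 1.
  apply: (@lebesgue_null_subset _ _ _ set0); last exact: lebesgue_null0.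
  move=> x /=.
  rewrite (msize1_polyC p1) /mpoly_fun mevalC => c0; move: p0.
  by rewrite (msize1_polyC p1) c0 mpolyC0 eqxx.
have [i dp0] := mderiv_neq0 p1.
pose N (b : bool) := if b then [set x | mpoly_fun p x = 0 /\ mpoly_fun (mderiv i p) x != 0]
   else [set x | mpoly_fun (mderiv i p) x = 0].
apply: (@lebesgue_null_subset _ _ _ (\bigcup_b N b)).
  move=> x /= px; have [dpx|dpx] := eqVneq (mpoly_fun (mderiv i p) x) 0.
    by exists false.
  by exists true.
apply: lebesgue_null_countable => -[]; first exact: lebesgue_null_regular_zeros.
by apply: IH => //; exact: ltn_msize_mderiv.
Qed.

(** * Coefficient map and its matrix of divided differences *)

Section Model.
Variables (R : realType) (n : nat) (M : model n).
Implicit Types (th : 'rV[R]_(#|param M|)).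

Lemma compartmental_mx_is_linear : linear (@compartmental_mx R n M).
Proof.
have eD a u v i j : edge_rate (a *: u + v : 'rV[R]_(#|param M|)) i j =
    a * edge_rate u i j + edge_rate v i j.
  by rewrite /edge_rate; case: insub => [e|]; rewrite ?mxE // mulr0 addr0.
have lD a u v i : leak_rate (a *: u + v : 'rV[R]_(#|param M|)) i =
    a * leak_rate u i + leak_rate v i.
  by rewrite /leak_rate; case: insub => [e|]; rewrite ?mxE // mulr0 addr0.
move=> a u v; apply/matrixP => i j; rewrite !mxE.
case: eqP => _; last exact: eD.
rewrite lD (eq_bigr (fun k => a * edge_rate u k i + edge_rate v k i)) => [|k _]; last exact: eD.
rewrite big_split /= -mulr_sumr; ring.
Qed.

HB.instance Definition _ := GRing.isLinear.Build R 'rV[R]_(#|param M|) 'M[R]_n.+1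
  _ (@compartmental_mx R n M) compartmental_mx_is_linear.

(** The parameters read off from a matrix: the weights of the edges are its
    entries, and a leak is the opposite of the column sum. *)
Definition params_of (C : 'M[R]_n.+1) : 'rV[R]_(#|param M|) :=
  \row_t match enum_val t : param M with
         | inl e => C (val e).2 (val e).1
         | inr l => - \sum_i C i (val l)
         end.

Lemma compartmental_mx_params_of (C : 'M[R]_n.+1) :
  {in edges M, forall e, e.1 != e.2} ->
  (forall i j, i != j -> (j, i) \notin edges M -> C i j = 0) ->
  (forall j, j \notin leaks M -> \sum_i C i j = 0) ->
  compartmental_mx (params_of C) = C.
Proof.
move=> loopfree C0 Csum.
have eE i j : edge_rate (params_of C) i j = if (j, i) \in edges M then C i j else 0.
  rewrite /edge_rate; case: insubP => [e -> ve|/negbTE -> //].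
  by rewrite mxE enum_rankK ve.
have lE i : leak_rate (params_of C) i = - \sum_l C l i.
  rewrite /leak_rate; case: insubP => [l _ vl|/Csum ->]; last by rewrite oppr0.
  by rewrite mxE enum_rankK vl.
apply/matrixP => i j; rewrite mxE; case: eqP => [<-|/eqP ij]; last first.
  by rewrite eE; case: ifPn => // /C0 ->.
rewrite lE opprK (bigD1 i) //=.
rewrite [X in _ - X](eq_bigr (fun l => C l i)) => [|l il]; last by rewrite eE il.
rewrite [X in _ + X - _](_ : _ = \sum_(l | (i, l) \in edges M) C l i) ?addrK //.
rewrite big_mkcond [RHS]big_mkcond; apply: eq_bigr => l _.
case: ifPn => [li|]; case: ifPn => // il.
  exact: C0.
by move/negbNE/eqP => li; have := loopfree _ il; rewrite /= li eqxx.
Qed.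
End Model.

Lemma size_adj_char_poly_mx (R : comNzRingType) (n : nat) (A : 'M[R]_n.+1) i :
  size (\adj (char_poly_mx A) i i) = n.+1.
Proof.
rewrite mxE /cofactor -signr_odd oddD addbb expr0 mul1r.
apply: etrans (size_char_poly (row' i (col' i A))).
rewrite /char_poly; congr (size (\det _ : {poly R})).
by apply/matrixP => a b; rewrite !mxE (inj_eq lift_inj).
Qed.

(** The constant coefficients left out of the coefficient map agree for all
    parameters, so the coefficient map determines the input-output equation. *)
Lemma coef_map_eq (R : realType) (n : nat) (M : model n)
    (th th' : 'rV[R]_(#|param M|)) :
  inputs M = [set ord0]%SET -> outputs M = [set ord0]%SET ->
  Defs.coef_map th = Defs.coef_map th' ->
  char_poly (compartmental_mx th) = char_poly (compartmental_mx th') /\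
  \adj (char_poly_mx (compartmental_mx th)) ord0 ord0 =
  \adj (char_poly_mx (compartmental_mx th')) ord0 ord0.
Proof.
move=> hI hO cE.
have ioE : io_polys R M = [:: (fun th => char_poly (compartmental_mx th));
    (fun th => \adj (char_poly_mx (compartmental_mx th)) ord0 ord0)].
  by rewrite /io_polys hI hO !enum_set1.
have : all (fun c => c th == c th') (io_coefs R M).
  apply/(all_nthP (cst 0)) => i iS.
  by have /rowP/(_ (Ordinal iS)) := cE; rewrite !mxE => ->.
have ds d : (d < n.+2)%N -> d \in iota 0 n.+2 by rewrite mem_iota.
rewrite /io_coefs all_filter ioE; move: (iota 0 n.+2) ds => ds dsP.
rewrite /= !all_cat andbT !all_map.
have keep (c : 'rV[R]_(#|param M|) -> R) :
    (`[< c <> cst 0 /\ c <> cst 1 >] ==> (c th == c th')) -> c th = c th'.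
  move=> /implyP h; have [c0|c0] := pselect (c = cst 0); first by rewrite c0.
  have [c1|c1] := pselect (c = cst 1); first by rewrite c1.
  by apply/eqP/h/asboolP.
move=> /andP[/allP h1 /allP h2]; split; apply/polyP => d.
  have [dn|dn] := ltnP d n.+2; last by rewrite !nth_default ?size_char_poly.
  by apply: (keep (fun th => (char_poly (compartmental_mx th))`_d)); apply: h1; exact: dsP.
have [dn|dn] := ltnP d n.+2; last by rewrite !nth_default // size_adj_char_poly_mx ltnW.
apply: (keep (fun th => (\adj (char_poly_mx (compartmental_mx th)) ord0 ord0)`_d)).
by apply: h2; exact: dsP.
Qed.

(** This is adj H (H' - H) adj H' = det H' adj H - det H adj H' for H = x - A and
    H' = x - A'. *)
Lemma adj_sub_adj00 (R : comNzRingType) (n : nat) (A A' : 'M[R]_n.+1) (x : R) i :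
  \det (x%:M - A) = \det (x%:M - A') -> \adj (x%:M - A) i i = \adj (x%:M - A') i i ->
  (\adj (x%:M - A) *m (A - A') *m \adj (x%:M - A')) i i = 0.
Proof.
move=> dE aE.
have -> : A - A' = (x%:M - A') - (x%:M - A) by rewrite opprB [RHS]addrC addrA subrK.
rewrite mulmxBr mulmxBl mul_adj_mx -mulmxA mul_mx_adj mul_mx_scalar mul_scalar_mx.
by rewrite dE -scalerBr mxE mxE [X in _ * (_ + X)]mxE aE subrr mulr0.
Qed.

Lemma adj_commutator_adj00 (R : comNzRingType) (n : nat) (A : 'M[R]_n.+1)
    (d : 'rV[R]_n.+1) (x : R) i :
  (\adj (x%:M - A) *m (diag_mx d *m A - A *m diag_mx d) *m \adj (x%:M - A)) i i = 0.
Proof.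
pose H := x%:M - A.
have -> : diag_mx d *m A - A *m diag_mx d = H *m diag_mx d - diag_mx d *m H.
  rewrite /H mulmxBl mulmxBr mul_scalar_mx mul_mx_scalar opprB.
  by rewrite [RHS]addrC addrA subrK.
rewrite -/H mulmxBr mulmxBl !mulmxA mul_adj_mx -(mulmxA _ H) mul_mx_adj.
rewrite mul_scalar_mx mul_mx_scalar -scalemxAl -scalerBr; move: (\adj H) => K.
by rewrite mul_diag_mx mul_mx_diag !mxE; ring.
Qed.

Section Jacobian.
Variables (R : realType) (n : nat) (M : model n) (s : seq R).

(** The matrix of the linear map sending [v] to the values, at the points x of
    [s], of (adj (x - A(th)) * A(v) * adj (x - A(th')))_11. It is used in place of
    the Jacobian matrix of the coefficient map. *)
Definition jacobian (th th' : 'rV[R]_(#|param M|)) : 'M[R]_(#|param M|, size s) :=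
  \matrix_(t, l) (\adj ((tnth (in_tuple s) l)%:M - compartmental_mx th)
     *m compartmental_mx (delta_mx 0 t)
     *m \adj ((tnth (in_tuple s) l)%:M - compartmental_mx th')) ord0 ord0.

Lemma mul_jacobian (v th th' : 'rV[R]_(#|param M|)) l :
  (v *m jacobian th th') 0 l =
  (\adj ((tnth (in_tuple s) l)%:M - compartmental_mx th) *m compartmental_mx v
     *m \adj ((tnth (in_tuple s) l)%:M - compartmental_mx th')) ord0 ord0.
Proof.
rewrite {2}[v]row_sum_delta linear_sum mulmx_sumr mulmx_suml summxE mxE.
apply: eq_bigr => t _; rewrite linearZ /= -scalemxAr -scalemxAl !mxE.
by [].
Qed.
End Jacobian.

(** * Transfer to a single leak *)

Section FullRank.
Variables (R : realType) (n : nat) (E : {set 'I_n.+1 * 'I_n.+1}) (k : 'I_n.+1).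
Variables (A : 'M[R]_n.+1) (T : {set 'I_n.+1 * 'I_n.+1}).
Local Notation o := (ord0 : 'I_n.+1).
Local Notation M := (Model E [set o]%SET [set o]%SET [set k]%SET).
Hypothesis WE : wired [set: 'I_n.+1]%SET E.
Hypothesis CA : certificate [set: 'I_n.+1]%SET E A T.

Let loopfree : {in E, forall e, e.1 != e.2}.
Proof. by case: WE => _ h _ e /h[]. Qed.

Variable y0 : R.
Hypothesis Ay0 : dominates A y0.

Variable r : 'rV[R]_n.+1.
Hypothesis r_gt0 : forall i, 0 < r 0 i.
Hypothesis rA : r *m (y0%:M - A) = delta_mx 0 k.
Let r_neq0 i : r 0 i != 0.
Proof. by rewrite gt_eqF. Qed.
Let r' : 'rV[R]_n.+1 := \row_i (r 0 i)^-1.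

(** The conjugate diag(r) (A - y0) diag(r)^-1, where [r] is row [k] of the inverse
    of y0 - A. *)
Definition one_leak_mx : 'M[R]_n.+1 := diag_mx r *m (A - y0%:M) *m diag_mx r'.

Lemma one_leak_mxE i j : one_leak_mx i j = r 0 i * (A - y0%:M) i j / r 0 j.
Proof. by rewrite /one_leak_mx mul_mx_diag mul_diag_mx !mxE. Qed.

Lemma diag_mxK : diag_mx r *m diag_mx r' = 1%:M.
Proof.
apply/matrixP => i j; rewrite mul_diag_mx !mxE.
have [->|_] := eqVneq i j; last by rewrite mulr0n mulr0.
by rewrite mulfV // r_neq0.
Qed.

Lemma sub_one_leak_mx y :
  (y - y0)%:M - one_leak_mx = diag_mx r *m (y%:M - A) *m diag_mx r'.
Proof.
have -> : (y - y0)%:M = diag_mx r *m (y - y0)%:M *m diag_mx r' :> 'M[R]_n.+1.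
  by rewrite mul_mx_scalar -scalemxAl diag_mxK scalemx1.
rewrite /one_leak_mx -mulmxBl -mulmxBr; congr (_ *m _ *m _).
by rewrite raddfB /= opprB addrA subrK.
Qed.

Lemma unit_sub_one_leak_mx y : dominates A y ->
  (y - y0)%:M - one_leak_mx \in unitmx /\
  invmx ((y - y0)%:M - one_leak_mx) = diag_mx r *m resolvent A y *m diag_mx r'.
Proof.
move=> Ay; have uy := certificate_unitmx CA Ay.
have K : (diag_mx r *m resolvent A y *m diag_mx r') *m ((y - y0)%:M - one_leak_mx) = 1%:M.
  rewrite sub_one_leak_mx !mulmxA -(mulmxA _ (diag_mx r')) (mulmx1C diag_mxK) mulmx1.
  by rewrite -(mulmxA (diag_mx r)) mulVmx // mulmx1 diag_mxK.
have [_ u] := mulmx1_unit K; split=> //.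
by rewrite -[LHS]mul1mx -K mulmxK.
Qed.

(** Only column [k] has a nonzero sum, so this is the compartmental matrix of a
    model with its single leak at [k]. *)
Lemma one_leak_mx_col j : \sum_i one_leak_mx i j = - (k == j)%:R / r 0 j.
Proof.
rewrite (eq_bigr (fun i => r 0 i * (A - y0%:M) i j / r 0 j)) => [|i _]; last exact: one_leak_mxE.
rewrite -mulr_suml; congr (_ / _).
have -> : \sum_i r 0 i * (A - y0%:M) i j = (r *m (A - y0%:M)) 0 j by rewrite [RHS]mxE.
by rewrite -opprB mulmxN rA !mxE eq_sym.
Qed.

Lemma one_leak_mx_nonedge i j : i != j -> (j, i) \notin E -> one_leak_mx i j = 0.
Proof.
move=> ij jiE; rewrite one_leak_mxE !mxE (cert_nonedge CA ij jiE) (negbTE ij).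
by rewrite mulr0n subr0 mulr0 mul0r.
Qed.

Definition one_leak_params : 'rV[R]_(#|param M|) := params_of M one_leak_mx.

Lemma compartmental_one_leak : compartmental_mx one_leak_params = one_leak_mx.
Proof.
apply: compartmental_mx_params_of => //=; first exact: one_leak_mx_nonedge.
move=> j; rewrite inE eq_sym one_leak_mx_col => /negbTE ->.
by rewrite oppr0 mul0r.
Qed.

(** The diagonal matrix whose commutator with [one_leak_mx] corrects the column
    sums of the elementary matrix of the entry [e]. Multiplied by [one_leak_mx] on
    the right, this vector gives the vector of those column sums. *)
Definition gauge (e : 'I_n.+1 * 'I_n.+1) : 'rV[R]_n.+1 :=
  - (delta_mx 0 e.1 *m invmx (0%:M - one_leak_mx)).

(** The elementary matrix of the entry [e], modified by a commutator so that it
    is the compartmental matrix of parameters of the one-leak model. *)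
Definition gauged_mx (e : 'I_n.+1 * 'I_n.+1) : 'M[R]_n.+1 :=
  delta_mx e.2 e.1 - (diag_mx (gauge e) *m one_leak_mx - one_leak_mx *m diag_mx (gauge e)).

Lemma compartmental_gauged (e : 'I_n.+1 * 'I_n.+1) : e \in T ->
  compartmental_mx (params_of M (gauged_mx e)) = gauged_mx e.
Proof.
case: e => j i jiT.
have : gauge (j, i) *m one_leak_mx = delta_mx 0 j.
  have [+ _] := unit_sub_one_leak_mx Ay0; rewrite subrr => u.
  pose H := 0%:M - one_leak_mx.
  have -> : gauge (j, i) = - (delta_mx 0 j *m invmx H) by [].
  have -> : one_leak_mx = - H by rewrite /H raddf0 sub0r opprK.
  by rewrite mulmxN mulNmx opprK mulmxKV.
rewrite /gauged_mx; move: (gauge _) => d /= dA.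
apply: compartmental_mx_params_of => //= [a b ab baE|b].
  have := one_leak_mx_nonedge ab baE; move: one_leak_mx {dA} => X X0.
  rewrite mul_diag_mx mul_mx_diag !mxE X0 mulr0 mul0r !subr0.
  case: eqP => //= ai; case: eqP => //= bj.
  have := cert_basis CA jiT; rewrite /= -ai -bj (negbTE baE) /= => /andP[/eqP ba _].
  by rewrite ba eqxx in ab.
rewrite inE eq_sym => /negbTE kb.
transitivity (\sum_a ((a == i) && (b == j))%:R - ((d *m one_leak_mx) 0 b
   - (\sum_a one_leak_mx a b) * d 0 b)).
  move: one_leak_mx {dA} => X.
  rewrite [(d *m _) 0 b]mxE mulr_suml -!sumrB; apply: eq_bigr => a _.
  by rewrite mul_diag_mx mul_mx_diag !mxE.
rewrite one_leak_mx_col kb oppr0 !mul0r subr0 dA !mxE /=.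
rewrite (bigD1 i) //= eqxx big1 => [|a /negbTE ->//].
by rewrite addr0 subrr.
Qed.

(** Each of the more than |E| independent functions of the certificate is, up to
    nonzero factors and the shift by y0, a combination of the rows of the
    jacobian, which has |E| + 1 rows. *)
Lemma full_rank_jacobian : exists s : seq R,
  row_free (jacobian s one_leak_params one_leak_params).
Proof.
have [ys ysP indys] := indep_on_finite (cert_indep CA).
exists [seq y - y0 | y <- ys].
set s := map _ ys; set J := jacobian _ _ _.
pose F (e : 'I_n.+1 * 'I_n.+1) (y : R) :=
  \adj (y%:M - one_leak_mx) o e.2 * \adj (y%:M - one_leak_mx) e.1 o.
have indF : indep_on (fun y => y \in s) T F.
  move=> c cF e eT.
  suff : c e * (r 0 e.1 / r 0 e.2) = 0.
    by move/eqP; rewrite !mulf_eq0 invr_eq0 !(negbTE (r_neq0 _)) !orbF => /eqP.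
  apply: (indys (fun e => c e * (r 0 e.1 / r 0 e.2))) => // y yys.
  have ys' : y - y0 \in s by apply: map_f.
  have [u uE] := unit_sub_one_leak_mx (ysP _ yys).
  have := cF _ ys'; set D := \det ((y - y0)%:M - one_leak_mx).
  rewrite (eq_bigr (fun e => D ^+ 2 * (c e * (r 0 e.1 / r 0 e.2) * edge_response A e y))).
    rewrite -mulr_sumr => /eqP; rewrite mulf_eq0 expf_eq0 /=.
    by move: u; rewrite unitmxE unitfE => /negbTE -> /= /eqP.
  move=> e' _; rewrite /F !adj_invmx // uE -/D /edge_response.
  move: (resolvent A y) => G.
  have GE i j : (D *: (diag_mx r *m G *m diag_mx r')) i j = D * (r 0 i * G i j / r 0 j).
    by rewrite mxE mul_mx_diag mul_diag_mx !mxE.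
  by rewrite !GE; field; rewrite !r_neq0.
have /row_free_sample_mx freeF := indF.
pose V := \matrix_(a < #|T|) params_of M (gauged_mx (enum_val a)).
have VJ : V *m J = sample_mx T F s.
  apply/matrixP => a l; rewrite [RHS]mxE.
  have -> : (V *m J) a l = (params_of M (gauged_mx (enum_val a)) *m J) 0 l.
    by have /rowP/(_ l) := row_mul a V J; rewrite rowK [LHS]mxE.
  rewrite mul_jacobian compartmental_gauged ?enum_valP // compartmental_one_leak.
  move: (tnth _ l) (enum_val a) => x e.
  rewrite /gauged_mx mulmxBr mulmxBl mxE [X in _ + X]mxE adj_commutator_adj00 oppr0 addr0.
  rewrite /F; move: (\adj _) => K.
  rewrite -(mul_delta_mx (0 : 'I_1)) mulmxA -mulmxA -colE -rowE mxE big_ord1.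
  by rewrite !mxE.
rewrite /row_free eqn_leq rank_leq_row /=.
have := freeF; rewrite -VJ /row_free => /eqP rk.
apply: (@leq_trans #|T|); last by have := mxrankM_maxr V J; rewrite rk.
by rewrite card_param cards1 addn1; exact: cert_card CA.
Qed.
End FullRank.

Lemma mpoly_fun_subring (R : realType) (m : nat) :
  fun_subring (fun f : 'rV[R]_m -> R => exists p : mpoly m R, f = mpoly_fun p).
Proof.
split=> [c|_ _ [p ->] [q ->]|_ _ [p ->] [q ->]].
- by exists (mpolyC m c); apply/funext => x; rewrite /mpoly_fun mevalC.
- by exists (p + q); apply/funext => x; rewrite /mpoly_fun mevalD.
- by exists (p * q); apply/funext => x; rewrite /mpoly_fun mevalM.
Qed.

Lemma fsr_linear (R : comNzRingType) (X : Type) (C : (X -> R) -> Prop) (m a b : nat)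
    (f : {linear 'rV[R]_m -> 'M[R]_(a, b)}) (v : X -> 'rV[R]_m) i j :
  fun_subring C -> (forall t, C (fun x => v x 0 t)) -> C (fun x => f (v x) i j).
Proof.
move=> CR Cv; apply: (@fsr_ext _ _ _ (fun x => \sum_t v x 0 t * f (delta_mx 0 t) i j)).
  move=> x; rewrite [v x in RHS]row_sum_delta linear_sum summxE.
  by apply: eq_bigr => t _; rewrite linearZ mxE.
by apply: (fsr_sum CR) => t _; apply: (fsr_mul CR) => //; exact: (fsr_cst CR).
Qed.

Lemma fsr_det_jacobian (R : realType) (n : nat) (M : model n) (s : seq R) (X : Type)
    (C : (X -> R) -> Prop) (Q : 'M[R]_(size s, #|param M|))
    (th th' : X -> 'rV[R]_(#|param M|)) :
  fun_subring C -> (forall t, C (fun x => th x 0 t)) -> (forall t, C (fun x => th' x 0 t)) ->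
  C (fun x => \det (jacobian s (th x) (th' x) *m Q)).
Proof.
move=> CR Cth Cth'.
have Cadj (u : X -> 'rV[R]_(#|param M|)) y i j : (forall t, C (fun x => u x 0 t)) ->
    C (fun x => \adj (y%:M - compartmental_mx (u x)) i j).
  move=> Cu; apply: (fsr_adj CR) => {}i {}j.
  apply: (@fsr_ext _ _ _ (fun x => (y%:M : 'M[R]_n.+1) i j + - compartmental_mx (u x) i j)).
    by move=> x; rewrite [RHS]mxE [X in _ = _ + X]mxE.
  apply: (fsr_add CR); first exact: (fsr_cst CR).
  by apply: (fsr_opp CR); apply: (fsr_linear _ _ _ CR Cu).
apply: (fsr_det CR) => i j; apply: (fsr_mulmx CR) => [t l|t l]; last exact: (fsr_cst CR).
apply: fsr_ext; first by move=> x; rewrite mxE.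
apply: (fsr_mulmx CR) => [a b|a b]; last exact: Cadj.
by apply: (fsr_mulmx CR) => [c d|c d]; [exact: Cadj | exact: (fsr_cst CR)].
Qed.

(** It suffices to exhibit one point where the jacobian has full row rank. *)
Lemma locally_identifiable_row_free (R : realType) (n : nat) (M : model n) (s : seq R)
    (th0 : 'rV[R]_(#|param M|)) :
  inputs M = [set ord0]%SET -> outputs M = [set ord0]%SET -> (0 < #|param M|)%N ->
  row_free (jacobian s th0 th0) -> locally_identifiable R M.
Proof.
move=> hI hO M_gt0 /row_freeP[Q JQ].
have [p pE] : exists p : mpoly #|param M| R,
    (fun th => \det (jacobian s th th *m Q)) = mpoly_fun p.
  have CR := mpoly_fun_subring R #|param M|.
  have Cc t : exists p : mpoly #|param M| R,
      (fun th : 'rV[R]_(#|param M|) => th 0 t) = mpoly_fun p.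
    exists (mpolyX R (mnm1 t)); apply/funext => th.
    by rewrite /mpoly_fun mevalXU.
  exact: (fsr_det_jacobian _ CR Cc Cc).
exists [set th | mpoly_fun p th = 0].
  have p0 : p != 0.
    apply/eqP => p0; have := congr1 (@^~ th0) pE.
    by rewrite /= JQ det1 p0 /mpoly_fun meval0 => /eqP; rewrite oner_eq0.
  move: p p0 {pE}; case: #|param M| M_gt0 => // m _ p; exact: lebesgue_null_zeros.
move=> th /= pth.
have CR := fun_subring_continuous R (th, th).
have : \forall z \near (th, th), \det (jacobian s z.1 z.2 *m Q) != 0.
  apply: near_neq0; last first.
    by rewrite /= -[\det _]/((fun th => \det (jacobian s th th *m Q)) th) pE; apply/eqP.
  apply: (fsr_det_jacobian _ CR) => t.
    apply: (@continuous_comp _ _ _ fst (fun x : 'rV[R]_(#|param M|) => x 0 t)); first exact: cvg_fst.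
    exact: coord_continuous.
  apply: (@continuous_comp _ _ _ snd (fun x : 'rV[R]_(#|param M|) => x 0 t)); first exact: cvg_snd.
  exact: coord_continuous.
move=> [[U1 U2] /= [U1th U2th] U12].
exists (U1 `&` U2); first exact: filterI.
move=> x y; rewrite !inE => -[U1x _] [_ U2y] cxy.
have [ec ea] := coef_map_eq hI hO cxy.
have dE : \det (jacobian s x y *m Q) != 0 by apply: (U12 (x, y)).
have uJ : jacobian s x y *m Q \in unitmx by rewrite unitmxE unitfE.
apply/eqP; rewrite -subr_eq0; apply/eqP.
rewrite -[LHS](mulmxK uJ) mulmxA.
have -> : (x - y) *m jacobian s x y = 0; last by rewrite !mul0mx.
apply/rowP => l; rewrite mul_jacobian [RHS]mxE; move: (tnth _ l) => a.
have -> : compartmental_mx (x - y) = compartmental_mx x - compartmental_mx y.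
  exact: linearB.
move: (compartmental_mx x) (compartmental_mx y) ec ea => A A' ec ea.
apply: adj_sub_adj00; first by rewrite -!horner_char_poly ec.
have := congr1 (fun P : {poly R} => P.[a]) ea.
by rewrite /= !horner_adj_char_poly_mx.
Qed.

Theorem theorem9p5 (R : realType) (n : nat)
    (E : {set 'I_n.+1 * 'I_n.+1}) (k : 'I_n.+1) :
  ear_graph [set: 'I_n.+1]%SET E ->
  locally_identifiable R (Model E [set ord0]%SET [set ord0]%SET [set k]%SET).
Proof.
move=> /(ear_graph_certificate R)[WE [A [T CA]]].
have [x0 _ dom] := dominates_ltr A.
have Ay0 : dominates A (x0 + 1) by apply: dom; rewrite ltrDl ltr01.
pose r := row k (resolvent A (x0 + 1)).
have r_gt0 i : 0 < r 0 i.
  by rewrite mxE; apply: (certificate_resolvent_gt0 WE CA Ay0); rewrite inE.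
have rA : r *m ((x0 + 1)%:M - A) = delta_mx 0 k.
  by rewrite -row_mul mulVmx ?row1 //; exact: certificate_unitmx CA _ Ay0.
have [s] := full_rank_jacobian WE CA Ay0 r_gt0 rA.
apply: locally_identifiable_row_free => //.
by rewrite card_param cards1 addn1.
Qed.
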